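(* If $(a_1,b_1)$ and $(a_2,b_2)$ are bi-Boolean independent pairs in a non-commutative probability space $(\mathcal{A},\varphi)$, then $$\widetilde\eta_{((1+a_1)(1+a_2),\,(1+b_2)(1+b_1))}(z,w)=\frac1z\,\eta_{1+a_1}(z)\cdot\widetilde\eta_{(1+a_2,1+b_2)}(z,w)+\frac1w\,\eta_{1+b_2}(w)\cdot\widetilde\eta_{(1+a_1,1+b_1)}(z,w).$$
   Context: All series are formal power series in commuting variables $z,w$. A non-commutative probability space $(\mathcal{A},\varphi)$ is a unital complex algebra with a unital linear functional $\varphi$. For $\chi:\{1,\dots,n\}\to\{\ell,r\}$ with $\chi^{-1}(\{\ell\})=\{i_1<\cdots<i_p\}$ and $\chi^{-1}(\{r\})=\{i_{p+1}>\cdots>i_n\}$, let $\prec_\chi$ be the total order $i_1\prec_\chi\cdots\prec_\chi i_n$; a $\chi$-interval is an interval for $\prec_\chi$. $\mathrm{BI}(\chi)$ is the set of partitions of $\{1,\dots,n\}$ all of whose blocks are $\chi$-intervals. For $V=\{v_1<\cdots<v_s\}$ put $(x_1,\dots,x_n)|_V=(x_{v_1},\dots,x_{v_s})$, and regard $\chi|_V$ as a map on $\{1,\dots,s\}$ via $v_i\leftrightarrow i$. The B-$(\ell,r)$-cumulants are the unique multilinear functionals $B_\chi:\mathcal{A}^n\to\mathbb{C}$ with $\varphi(x_1\cdots x_n)=\sum_{\pi\in\mathrm{BI}(\chi)}\prod_{V\in\pi}B_{\chi|_V}((x_1,\dots,x_n)|_V)$ for all $n\ge1$, $\chi$, $x_1,\dots,x_n$.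 $\chi_{m,n}:\{1,\dots,m+n\}\to\{\ell,r\}$ is $\ell$ on $\{1,\dots,m\}$ and $r$ on $\{m+1,\dots,m+n\}$; $B_{m,n}(x,y)=B_{\chi_{m,n}}(x,\dots,x,y,\dots,y)$ ($m$ copies of $x$, then $n$ copies of $y$); $B_m(x)=B_\chi(x,\dots,x)$ for constant $\chi:\{1,\dots,m\}\to\{\ell,r\}$. The Boolean $\eta$-transform is $\eta_x(z)=\sum_{m\ge1}B_m(x)z^m$, and the reduced bi-Boolean partial $\eta$-transform is $\widetilde\eta_{(x,y)}(z,w)=\sum_{m,n\ge1}B_{m,n}(x,y)z^mw^n$. For $\omega:\{1,\dots,n\}\to K$, $\pi_{\omega,\chi}$ is the unique maximal partition of $\{1,\dots,n\}$ whose blocks are $\chi$-intervals on each of which $\omega$ is constant. For a partition $\pi$, $\varphi_\pi(x_1,\dots,x_n)=\prod_{V=\{v_1<\cdots<v_s\}\in\pi}\varphi(x_{v_1}\cdots x_{v_s})$. A family $\{(\mathcal{A}_{k,\ell},\mathcal{A}_{k,r})\}_{k\in K}$ of pairs of (not required to be unital) subalgebras is bi-Boolean independent if $\varphi(x_1\cdots x_n)=\varphi_{\pi_{\omega,\chi}}(x_1,\dots,x_n)$ for all $n\ge1$, $\chi$, $\omega$, and $x_j\in\mathcal{A}_{\omega(j),\chi(j)}$. Pairs $(a_1,b_1),(a_2,b_2)$ are bi-Boolean independent if the pairs of non-unital algebras $(\mathrm{alg}(a_k),\mathrm{alg}(b_k))$, $k=1,2$, generated by $a_k$ (left) and $b_k$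 (right), are. *)

(* Defs.v *)
From HB Require Import structures.
From mathcomp Require Import all_boot all_order all_algebra.
From mathcomp Require Import zify.
From mathcomp Require Import boolp.
From mathcomp Require classical_sets.
From mathcomp Require Export reals complex.

Set Implicit Arguments.
Unset Strict Implicit.
Unset Printing Implicit Defensive.

Import GRing.Theory.
Local Open Scope ring_scope.

Variant side := Left | Right.

Section ChiOrder.
Variables (n : nat) (chi : {ffun 'I_n -> side}).

(* Left indices come first, increasingly; then right indices, decreasingly. *)
Definition chi_lt (i j : 'I_n) : bool :=
  match chi i, chi j with
  | Left, Left => (i < j)%N
  | Left, Right => true
  | Right, Left => false
  | Right, Right => (j < i)%N
  end.

Definition chi_interval (V : {set 'I_n}) : bool :=
  [forall i in V, forall k in V, forall j,
     (chi_lt i j && chi_lt j k) ==> (j \in V)].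

Definition interval_partition (P : {set {set 'I_n}}) : bool :=
  partition P [set: 'I_n] && [forall V in P, chi_interval V].

Definition refines (P Q : {set {set 'I_n}}) : bool :=
  [forall V in P, exists W in Q, V \subset W].

Section Colored.
Variables (K : eqType) (omega : {ffun 'I_n -> K}).

Definition constant_on (V : {set 'I_n}) : bool :=
  [forall i in V, forall j in V, omega i == omega j].

Definition monochromatic_interval_partition (P : {set {set 'I_n}}) : bool :=
  interval_partition P && [forall V in P, constant_on V].

(* [P] is the partition pi_(omega, chi); see [pi_omega_chi_unique] below. *)
Definition is_pi_omega_chi (P : {set {set 'I_n}}) : Prop :=
  monochromatic_interval_partition P /\
  forall Q, monochromatic_interval_partition Q -> refines P Q -> Q = P.

End Colored.
End ChiOrder.

(* [enum_val] lists the elements of [V] increasingly. *)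
Definition restr (T : Type) (n : nat) (x : {ffun 'I_n -> T}) (V : {set 'I_n}) :
    {ffun 'I_#|V| -> T} :=
  [ffun i => x (enum_val i)].

Section Cumulants.
Variables (C : fieldType) (A : algType C).

Definition functional_family : Type :=
  forall n : nat, {ffun 'I_n -> side} -> {ffun 'I_n -> A} -> C.

Definition set_arg (n : nat) (x : {ffun 'I_n -> A}) (i : 'I_n) (u : A) :
    {ffun 'I_n -> A} :=
  [ffun j => if j == i then u else x j].

Definition multilinear (n : nat) (f : {ffun 'I_n -> A} -> C) : Prop :=
  forall (x : {ffun 'I_n -> A}) (i : 'I_n) (c : C) (u v : A),
    f (set_arg x i (c *: u + v)) = c * f (set_arg x i u) + f (set_arg x i v).

(* The members of arity 0 are left unconstrained; they play no role. *)
Definition is_lr_cumulants (phi : {scalar A}) (B : functional_family) : Prop :=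
  (forall (n : nat) (chi : {ffun 'I_n -> side}),
     (0 < n)%N -> multilinear (@B n chi)) /\
  (forall (n : nat) (chi : {ffun 'I_n -> side}) (x : {ffun 'I_n -> A}),
     (0 < n)%N ->
     phi (\prod_(i < n) x i) =
     \sum_(P : {set {set 'I_n}} | interval_partition chi P)
        \prod_(V in P) B #|V| (restr chi V) (restr x V)).

Definition chi_mn (m n : nat) : {ffun 'I_(m + n) -> side} :=
  [ffun i : 'I_(m + n) => if (i < m)%N then Left else Right].

Definition args_mn (m n : nat) (x y : A) : {ffun 'I_(m + n) -> A} :=
  [ffun i : 'I_(m + n) => if (i < m)%N then x else y].

Definition B_mn (B : functional_family) (x y : A) (m n : nat) : C :=
  B (m + n)%N (chi_mn m n) (args_mn m n x y).

(* The constant map [Right] would give the same value;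
   see [B_const_side] below. *)
Definition B_m (B : functional_family) (x : A) (m : nat) : C :=
  B m [ffun=> Left] [ffun=> x].

End Cumulants.

Section Series.
Variable C : fieldType.

(* The coefficient of z^m in [f : fps1 C] is [f m]; the coefficient of
   z^m w^n in [f : fps2 C] is [f m n]. *)
Definition fps1 : Type := nat -> C.
Definition fps2 : Type := nat -> nat -> C.

Definition fps2_add (f g : fps2) : fps2 := fun m n => f m n + g m n.

Definition fps2_mul (f g : fps2) : fps2 := fun m n =>
  \sum_(i < m.+1) \sum_(j < n.+1) f i j * g (m - i)%N (n - j)%N.

Definition in_z (f : fps1) : fps2 := fun m n => if n == 0%N then f m else 0.
Definition in_w (f : fps1) : fps2 := fun m n => if m == 0%N then f n else 0.

Definition fps2_z : fps2 := fun m n => ((m == 1%N) && (n == 0%N))%:R.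
Definition fps2_w : fps2 := fun m n => ((m == 0%N) && (n == 1%N))%:R.

(* Multiplication by 1/z and 1/w; meaningful for series divisible by z, resp.
   by w. See [mul_z_div_z] and [mul_w_div_w] below. *)
Definition div_z (f : fps2) : fps2 := fun m n => f m.+1 n.
Definition div_w (f : fps2) : fps2 := fun m n => f m n.+1.

Variable A : algType C.

Definition eta_transform (B : functional_family A) (x : A) : fps1 := fun m =>
  if (0 < m)%N then B_m B x m else 0.

Definition reduced_eta_transform (B : functional_family A) (x y : A) : fps2 :=
  fun m n =>
  if (0 < m)%N && (0 < n)%N then B_mn B x y m n else 0.

End Series.

Declare Scope fps2_scope.
Delimit Scope fps2_scope with fps2.
Bind Scope fps2_scope with fps2.
Notation "f + g" := (fps2_add f g) : fps2_scope.
Notation "f * g" := (fps2_mul f g) : fps2_scope.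

Section Independence.
Variables (C : fieldType) (A : algType C).

Definition nonunital_subalgebra (S : classical_sets.set A) : Prop :=
  [/\ S 0,
      forall (c : C) (x y : A), S x -> S y -> S (c *: x + y)
    & forall x y : A, S x -> S y -> S (x * y)].

Definition nonunital_alg (a : A) : classical_sets.set A :=
  classical_sets.smallest nonunital_subalgebra (classical_sets.set1 a).

Definition phi_part (phi : {scalar A}) (n : nat) (P : {set {set 'I_n}})
    (x : {ffun 'I_n -> A}) : C :=
  \prod_(V in P) phi (\prod_(i < #|V|) restr x V i).

(* [S k Left] and [S k Right] are the left and right algebras of index [k]. *)
Definition bi_Boolean_independent (phi : {scalar A}) (K : eqType)
    (S : K -> side -> classical_sets.set A) : Prop :=
  (forall k s, nonunital_subalgebra (S k s)) /\
  forall (n : nat) (chi : {ffun 'I_n -> side}) (omega : {ffun 'I_n -> K})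
         (x : {ffun 'I_n -> A}) (P : {set {set 'I_n}}),
    (0 < n)%N ->
    (forall j, S (omega j) (chi j) (x j)) ->
    is_pi_omega_chi chi omega P ->
    phi (\prod_(i < n) x i) = phi_part phi P x.

Definition pairs_bi_Boolean_independent (phi : {scalar A})
    (a1 b1 a2 b2 : A) : Prop :=
  bi_Boolean_independent phi (fun (k : 'I_2) (s : side) =>
    match s with
    | Left => nonunital_alg (if k == 0 then a1 else a2)
    | Right => nonunital_alg (if k == 0 then b1 else b2)
    end).

End Independence.

Lemma nonunital_alg_subalgebra (C : fieldType) (A : algType C) (a : A) :
  nonunital_subalgebra (nonunital_alg a).
Proof.
split.
- by move=> S [[S0 _ _] _].
- by move=> c x y Sx Sy S [hS aS]; case: (hS) => _ h _; apply: h; [apply: Sx|apply: Sy].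
- by move=> x y Sx Sy S [hS aS]; case: (hS) => _ _ h; apply: h; [apply: Sx|apply: Sy].
Qed.

Section PiUnique.
Variables (n : nat) (chi : {ffun 'I_n -> side}).
Variables (K : eqType) (omega : {ffun 'I_n -> K}).
Implicit Types P Q : {set {set 'I_n}}.

Let key (i : 'I_n) : nat := if chi i is Left then i else (2 * n - i)%N.

Let chi_ltE i j : chi_lt chi i j = (key i < key j)%N.
Proof.
rewrite /chi_lt /key; have := ltn_ord i; have := ltn_ord j.
by case: (chi i); case: (chi j); lia.
Qed.

Let key_inj i j : key i = key j -> i = j.
Proof.
rewrite /key; have := ltn_ord i; have := ltn_ord j => hi hj.
by case: (chi i); case: (chi j) => h; apply: val_inj => /=; lia.
Qed.

Let same (i j : 'I_n) : bool :=
  [forall k : 'I_n, ((key i <= key k <= key j) || (key j <= key k <= key i))%N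
     ==> (omega k == omega i)].

Let sameP i j : reflect (forall k : 'I_n,
    ((key i <= key k <= key j) || (key j <= key k <= key i))%N ->
    omega k = omega i) (same i j).
Proof.
apply: (iffP forallP) => h k; last by apply/implyP => /h ->.
by move=> hk; have /implyP/(_ hk)/eqP := h k.
Qed.

Let same_omega i j : same i j -> omega j = omega i.
Proof. by move=> /sameP; apply; lia. Qed.

Let same_equiv : {in [set: 'I_n] & &, equivalence_rel same}.
Proof.
have refl i : same i i.
  by apply/sameP => k hk; congr (omega _); apply: key_inj; lia.
have sym i j : same i j -> same j i.
  by move=> h; have e := same_omega h; apply/sameP => k hk; rewrite e; apply: (sameP _ _ h); lia.
have trans i j k : same i j -> same j k -> same i k.
  move=> h1 h2; have e := same_omega h1; apply/sameP => l hl.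
  have [h|h] := boolP ((key i <= key l <= key j) || (key j <= key l <= key i))%N.
    exact: (sameP _ _ h1).
  by rewrite -e; apply: (sameP _ _ h2); lia.
move=> i j k _ _ _; split=> [|hij]; first exact: refl.
by apply/idP/idP; apply: trans => //; apply: sym.
Qed.

Let P0 := equivalence_partition same [set: 'I_n].

Let P0_partition : partition P0 [set: 'I_n].
Proof. exact: equivalence_partitionP same_equiv. Qed.

Let P0_same V i j : V \in P0 -> i \in V -> j \in V = same i j.
Proof.
move=> VP iV; have /and3P [_ tr _] := P0_partition.
rewrite -(def_pblock tr VP iV).
by rewrite (pblock_equivalence_partition same_equiv) ?inE.
Qed.

Let P0_mono : monochromatic_interval_partition chi omega P0.
Proof.
apply/andP; split; first (apply/andP; split => //).
  apply/forall_inP => V VP; apply/forall_inP => i iV; apply/forall_inP => k kV.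
  apply/forallP => j; apply/implyP; rewrite !chi_ltE => hj.
  move: kV; rewrite (P0_same k VP iV) (P0_same j VP iV) => /sameP h.
  by apply/sameP => l hl; apply: h; lia.
apply/forall_inP => V VP; apply/forall_inP => i iV; apply/forall_inP => k kV.
by move: kV; rewrite (P0_same k VP iV) => /same_omega ->.
Qed.

Let refines_P0 Q : monochromatic_interval_partition chi omega Q -> refines Q P0.
Proof.
move=> /andP[/andP[Qp /forall_inP Qi] /forall_inP Qc].
apply/forall_inP => V VQ; have /and3P [_ _ Q0] := Qp.
have [i iV] : exists i, i \in V.
  by apply/set0Pn; apply: contraNneq Q0 => <-.
have /and3P [/eqP cov tr _] := P0_partition.
have iP : i \in cover P0 by rewrite cov inE.
apply/exists_inP; exists (pblock P0 i); first exact: pblock_mem.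
apply/subsetP => j jV.
have iB : i \in pblock P0 i by rewrite mem_pblock.
rewrite (P0_same j (pblock_mem iP) iB).
apply/sameP => k hk.
suff kV : k \in V.
  by have /forall_inP/(_ k kV)/forall_inP/(_ i iV)/eqP := Qc V VQ.
have [/key_inj -> //|nki] := eqVneq (key k) (key i).
have [/key_inj -> //|nkj] := eqVneq (key k) (key j).
have /forall_inP hI := Qi V VQ.
have [hik|hki] := ltnP (key i) (key k).
  have /forall_inP/(_ j jV)/forallP/(_ k)/implyP := hI i iV.
  by rewrite !chi_ltE; apply; lia.
have /forall_inP/(_ i iV)/forallP/(_ k)/implyP := hI j jV.
by rewrite !chi_ltE; apply; lia.
Qed.

Let refines_anti P Q : partition P [set: 'I_n] -> partition Q [set: 'I_n] ->
  refines P Q -> refines Q P -> P = Q.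
Proof.
have half P' Q' : partition P' [set: 'I_n] ->
    refines P' Q' -> refines Q' P' -> P' \subset Q'.
  move=> /and3P [_ tr P0'] /forall_inP h1 /forall_inP h2.
  apply/subsetP => V VP.
  have [W WQ VW] := exists_inP (h1 V VP).
  have [V' VP' WV'] := exists_inP (h2 W WQ).
  have [i iV] : exists i, i \in V.
    by apply/set0Pn; apply: contraNneq P0' => <-.
  have eV : V = V'.
    rewrite -(def_pblock tr VP iV); apply: (def_pblock tr VP').
    by apply: (subsetP WV'); apply: (subsetP VW).
  suff -> : V = W by [].
  by apply/eqP; rewrite eqEsubset VW eV WV'.
move=> hP hQ h1 h2; apply/eqP; rewrite eqEsubset.
by rewrite (half P Q) // (half Q P).
Qed.

Lemma pi_omega_chi_unique : exists! P, is_pi_omega_chi chi omega P.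
Proof.
exists P0; split.
  split=> // Q hQ h; apply: refines_anti => //; last exact: refines_P0.
  by case/andP: hQ => /andP[].
by move=> P [hP h]; apply: h => //; apply: refines_P0.
Qed.

End PiUnique.

Section CumulantsWellDefined.
Variables (C : fieldType) (A : algType C) (phi : {scalar A}).
Implicit Types (B : functional_family A).

Let cast_family B m n (e : m = n) (chi : {ffun 'I_n -> side})
    (x : {ffun 'I_n -> A}) :
  B m [ffun i => chi (cast_ord e i)] [ffun i => x (cast_ord e i)] = B n chi x.
Proof.
case: n / e chi x => chi x.
by congr (B m _ _); apply/ffunP => i; rewrite ffunE cast_ord_id.
Qed.

Let enum_val_setT n (i : 'I_#|[set: 'I_n]|) (e : #|[set: 'I_n]| = n) :
  enum_val i = cast_ord e i.
Proof.
apply: val_inj => /=; rewrite /enum_val.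
set x0 := enum_default i.
have -> : enum [set: 'I_n] = enum 'I_n by apply: eq_enum => j; rewrite inE.
by rewrite nth_enum_ord //; apply: leq_trans (ltn_ord i) _; rewrite e.
Qed.

Let restr_setT B n (chi : {ffun 'I_n -> side}) (x : {ffun 'I_n -> A}) :
  B _ (restr chi [set: 'I_n]) (restr x [set: 'I_n]) = B n chi x.
Proof.
have e : #|[set: 'I_n]| = n by rewrite cardsT card_ord.
rewrite -(cast_family B e chi x); congr (B _ _ _);
  by apply/ffunP => i; rewrite !ffunE (enum_val_setT i e).
Qed.

Let one_block n : (0 < n)%N -> forall chi : {ffun 'I_n -> side},
  interval_partition chi [set [set: 'I_n]].
Proof.
move=> n0 chi; apply/andP; split.
  apply/and3P; split; first by rewrite /cover big_set1.
    apply/trivIsetP => V W; rewrite !inE => /eqP -> /eqP ->.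
    by rewrite eqxx.
  rewrite inE; apply/eqP => h.
  by have := in_set0 (Ordinal n0); rewrite h inE.
apply/forall_inP => V; rewrite inE => /eqP ->.
by do 2!apply/forall_inP => ? _; apply/forallP => ?; rewrite inE implybT.
Qed.

Let block_lt n (P : {set {set 'I_n}}) (V : {set 'I_n}) :
  partition P [set: 'I_n] -> P != [set [set: 'I_n]] -> V \in P ->
  (#|V| < n)%N.
Proof.
move=> hP nP VP; rewrite ltn_neqAle.
rewrite -[X in (_ <= X)%N]card_ord max_card andbT.
apply: contraNneq nP => cV.
have VT : V = [set: 'I_n].
  by apply/eqP; rewrite eqEcard subsetT cardsT card_ord cV /=.
rewrite -VT; apply/eqP/setP => W; rewrite inE.
apply/idP/eqP => [WP|->//]; have /and3P [_ tr P0'] := hP.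
have [i iW] : exists i, i \in W.
  by apply/set0Pn; apply: contraNneq P0' => <-.
by rewrite -(def_pblock tr WP iW); apply: def_pblock => //; rewrite VT inE.
Qed.

Let block_gt0 n (P : {set {set 'I_n}}) (V : {set 'I_n}) :
  partition P [set: 'I_n] -> V \in P -> (0 < #|V|)%N.
Proof.
move=> /and3P [_ _ P0'] VP; rewrite card_gt0.
by apply: contraNneq P0' => <-.
Qed.

Let lower B n (chi : {ffun 'I_n -> side}) (x : {ffun 'I_n -> A}) : C :=
  \sum_(P : {set {set 'I_n}} |
         interval_partition chi P && (P != [set [set: 'I_n]]))
     \prod_(V in P) B #|V| (restr chi V) (restr x V).

Let split_sum B n (chi : {ffun 'I_n -> side}) (x : {ffun 'I_n -> A}) :
  (0 < n)%N ->
  \sum_(P : {set {set 'I_n}} | interval_partition chi P)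
        \prod_(V in P) B #|V| (restr chi V) (restr x V) =
  B n chi x + lower B chi x.
Proof.
move=> n0; rewrite (bigD1 [set [set: 'I_n]]) ?one_block //=.
by rewrite big_set1 restr_setT.
Qed.

Let eq_lower B B' n (chi : {ffun 'I_n -> side}) (x : {ffun 'I_n -> A}) :
  (forall m (chi' : {ffun 'I_m -> side}) x', (0 < m < n)%N ->
     B m chi' x' = B' m chi' x') ->
  lower B chi x = lower B' chi x.
Proof.
move=> h; apply: eq_bigr => P /andP[/andP[hP _] nP].
by apply: eq_bigr => V VP; apply: h; rewrite (block_gt0 hP) ?(block_lt hP).
Qed.

Lemma lr_cumulants_unique B B' :
  is_lr_cumulants phi B -> is_lr_cumulants phi B' ->
  forall n (chi : {ffun 'I_n -> side}) x, (0 < n)%N ->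
    B n chi x = B' n chi x.
Proof.
move=> [_ hB] [_ hB'] n; have [k] := ubnP n.
elim: k n => // k IH n lenk chi x n0.
have := hB n chi x n0; rewrite (hB' n chi x n0) !split_sum //.
rewrite (@eq_lower B B') => [/addIr //|m chi' x' /andP[m0 mn]].
by apply: IH => //; lia.
Qed.

Let Bfuel : nat -> functional_family A :=
  fix rec k := match k with
  | 0 => fun n chi x => 0
  | k'.+1 => fun n chi x => phi (\prod_(i < n) x i) - lower (rec k') chi x
  end.

Let BfuelE k n (chi : {ffun 'I_n -> side}) (x : {ffun 'I_n -> A}) :
  (0 < n <= k)%N -> Bfuel k chi x = Bfuel n chi x.
Proof.
have [j] := ubnP n; elim: j k n chi x => // j IH [|k] [|n] chi x //= lt le.
congr (_ - _); apply: eq_lower => m chi' x' hm.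
by rewrite IH; [rewrite [RHS]IH//; lia|lia|lia].
Qed.

Let set_arg_out n (x : {ffun 'I_n -> A}) i u (V : {set 'I_n}) :
  i \notin V -> restr (set_arg x i u) V = restr x V.
Proof.
move=> iV; apply/ffunP => j; rewrite !ffunE ifN //.
by apply: contraNneq iV => <-; apply: enum_valP.
Qed.

Let set_arg_in n (x : {ffun 'I_n -> A}) i u (V : {set 'I_n}) (iV : i \in V) :
  restr (set_arg x i u) V = set_arg (restr x V) (enum_rank_in iV i) u.
Proof.
apply/ffunP => j; rewrite !ffunE; congr (if _ then _ else _).
apply/eqP/eqP => [h|->]; first by apply: enum_val_inj; rewrite enum_rankK_in.
by rewrite enum_rankK_in.
Qed.

Let phi_multilinear n :
  multilinear (fun x : {ffun 'I_n -> A} => phi (\prod_(i < n) x i)).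
Proof.
have aux (s : seq 'I_n) (x : {ffun 'I_n -> A}) i c u v : uniq s ->
    \prod_(j <- s) set_arg x i (c *: u + v) j =
    if i \in s then c *: \prod_(j <- s) set_arg x i u j
                    + \prod_(j <- s) set_arg x i v j
    else \prod_(j <- s) x j.
  elim: s => [|a s IH] /=; first by rewrite !big_nil.
  move=> /andP[nas us]; rewrite !big_cons IH // inE !ffunE eq_sym.
  have [->|_] /= := eqVneq i a.
    rewrite (negPf nas) mulrDl -scalerAl.
    have e w : \prod_(j <- s) set_arg x a w j = \prod_(j <- s) x j.
      rewrite big_seq [RHS]big_seq; apply: eq_bigr => j js.
      by rewrite ffunE ifN //; apply: contraNneq nas => <-.
    by rewrite !e.
  by case: ifP => // _; rewrite mulrDr scalerAr.
move=> x i c u v; rewrite aux ?index_enum_uniq // mem_index_enum.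
by rewrite linearP.
Qed.

Let lower_multilinear B n (chi : {ffun 'I_n -> side}) :
  (forall m (chi' : {ffun 'I_m -> side}), (0 < m < n)%N ->
     multilinear (@B m chi')) ->
  multilinear (fun x => lower B chi x).
Proof.
move=> hB x i c u v; rewrite /lower mulr_sumr -big_split /=.
apply: eq_bigr => P /andP[/andP[hP _] nP].
have /and3P [/eqP cov tr _] := hP.
have iP : i \in cover P by rewrite cov inE.
have WP := pblock_mem iP; have iW : i \in pblock P i by rewrite mem_pblock.
rewrite !(bigD1 _ WP) /=.
have e w : \prod_(V in P | V != pblock P i)
      B #|V| (restr chi V) (restr (set_arg x i w) V) =
    \prod_(V in P | V != pblock P i) B #|V| (restr chi V) (restr x V).
  apply: eq_bigr => V /andP[VP nV]; rewrite set_arg_out //.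
  by apply: contraNN nV => iV; rewrite (def_pblock tr VP iV).
rewrite !e !(set_arg_in _ _ iW) hB ?mulrDl ?mulrA //.
by rewrite (block_gt0 hP) ?(block_lt hP).
Qed.

Lemma lr_cumulants_exist : exists B, is_lr_cumulants phi B.
Proof.
exists (fun n => @Bfuel n n); split=> [n|n chi x n0]; last first.
  rewrite (split_sum (fun m => @Bfuel m m)) //; case: n chi x n0 => // n chi x _ /=.
  rewrite (@eq_lower _ (Bfuel n)) ?subrK // => m chi' x' hm.
  by rewrite BfuelE //; lia.
have [j] := ubnP n; elim: j n => // j IH [|n] // lt chi _ x i c u v /=.
rewrite phi_multilinear lower_multilinear; first by rewrite mulrBr opprD addrACA.
move=> m chi' /andP[m0 mn] y k d s t; rewrite !BfuelE; try lia.
by apply: IH => //; lia.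
Qed.

Lemma B_const_side B m (x : {ffun 'I_m -> A}) :
  is_lr_cumulants phi B -> (0 < m)%N ->
  B m [ffun=> Left] x = B m [ffun=> Right] x.
Proof.
move=> [_ hB]; have [k] := ubnP m; elim: k m x => // k IH m x lt m0.
have eI : interval_partition [ffun=> Left] =1
          interval_partition ([ffun=> Right] : {ffun 'I_m -> side}).
  move=> P; rewrite /interval_partition; congr (_ && _).
  apply: eq_forallb => V; congr (_ ==> _).
  by apply/forall_inP/forall_inP => h i iV; apply/forall_inP => l lV;
    apply/forallP => j; apply/implyP => /andP[h1 h2];
    have /forall_inP/(_ i iV)/forallP/(_ j)/implyP := h l lV; apply;
    move: h1 h2; rewrite /chi_lt !ffunE => -> ->.
have rc s (V : {set 'I_m}) : restr [ffun=> s] V = [ffun=> s].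
  by apply/ffunP => j; rewrite !ffunE.
have := hB m [ffun=> Left] x m0; rewrite (hB m [ffun=> Right] x m0) !split_sum //.
suff -> : lower B [ffun=> Left] x = lower B [ffun=> Right] x by move=> /addIr.
apply: eq_big => [P|P /andP[/andP[hP _] nP]]; first by rewrite eI.
apply: eq_bigr => V VP; rewrite !rc; apply: IH.
  by have := block_lt hP nP VP; lia.
exact: block_gt0 VP.
Qed.

End CumulantsWellDefined.

Section DivisionByVariables.
Variable C : fieldType.
Implicit Type f : fps2 C.

Lemma mul_z_div_z f : (forall n, f 0%N n = 0) -> fps2_mul (fps2_z C) (div_z f) = f.
Proof.
move=> f0; apply/funext => m; apply/funext => n; rewrite /fps2_mul /fps2_z /div_z.
case: m => [|m].
  by rewrite f0 big1 // => i _; rewrite big1 // => j _; rewrite ord1 mul0r.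
have z k (F : nat -> C) : \sum_(j < k) 0 * F j = 0.
  by rewrite big1 // => j _; rewrite mul0r.
rewrite !big_ord_recl /= !(z _ (fun j => f _ (n - bump 0 j)%N)) !mul0r mul1r.
rewrite [\sum_(i < m) _]big1 => [|i _]; last first.
  exact: (z _ (fun j => f _ (n - j)%N)).
by rewrite !addr0 add0r /bump /= !subn0 subn1.
Qed.

Lemma mul_w_div_w f : (forall m, f m 0%N = 0) -> fps2_mul (fps2_w C) (div_w f) = f.
Proof.
move=> f0; apply/funext => m; apply/funext => n; rewrite /fps2_mul /fps2_w /div_w.
rewrite big_ord_recl [X in _ + X]big1 => [|i _]; last first.
  by rewrite big1 // => j _; rewrite mul0r.
case: n => [|n]; first by rewrite f0 big_ord1 mul0r addr0.
rewrite !big_ord_recl /= big1 => [|j _]; last by rewrite mul0r.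
by rewrite mul0r mul1r add0r !addr0 /bump /= !subn0 subn1.
Qed.

End DivisionByVariables.

(* Main.v *)
Require Import Defs.
From HB Require Import structures.
From mathcomp Require Import all_boot all_order all_algebra.
From mathcomp Require Import zify ring boolp.
From mathcomp Require classical_sets.

Set Implicit Arguments.
Unset Strict Implicit.
Unset Printing Implicit Defensive.

Import GRing.Theory.
Local Open Scope ring_scope.

(* Write x = (1 + a1) (1 + a2), y = (1 + b2) (1 + b1), and let H_u(z) be the
   series of the phi(u^m) z^m.  Splitting off the block of the first element of
   an interval partition gives H_u = 1 + eta_u H_u and, for the joint moments,
     sum phi(x^m y^n) z^m w^n = H_x(z) H_y(w) (1 + reduced eta_(x,y)(z,w)),
   so H_x H_y (reduced eta) is the series of the covariances of x^m and y^n.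

   For the order of chi, a left word times a right word has its runs lined up
   in one row, and only the two innermost runs can merge.  Hence the covariance
   of two words is unchanged when every other run is replaced by its phi, and
   vanishes unless the innermost runs have the same colour: it is the sum over
   the colours k of the covariances of their projections to the algebras of
   colour k.  The projections of x^m to the colours 1 and 2 are, up to
   constants, the coefficients of F(z) / (1 - z (1 + a1)) and
   G(z) / (1 - z (1 + a2)) for scalar series F and G; applying phi yields
   F H_(1 + a1) = H_x and G H_(1 + a2) = H_x eta_(1 + a1) / z.  With the same
   for y, cancelling H_x H_y gives the formula. *)

(** * Formal power series *)

(** [fps2 C] is [series (series C)] up to conversion, so applying the ring structure below twice
    makes [ring] available for two-variable series. *)
Definition series (T : Type) : Type := nat -> T.

HB.instance Definition _ (T : choiceType) := gen_eqMixin (series T).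
HB.instance Definition _ (T : choiceType) := gen_choiceMixin (series T).

Definition series_tail (T : Type) (f : series T) : series T := fun n => f n.+1.

Section SeriesRing.
Variable T : comNzRingType.
Implicit Types f g h : series T.

Definition series_zero : series T := fun=> 0.
Definition series_opp f : series T := fun n => - f n.
Definition series_add f g : series T := fun n => f n + g n.

Fact series_addA : associative series_add.
Proof. by move=> f g h; apply/funext => n; apply: addrA. Qed.
Fact series_addC : commutative series_add.
Proof. by move=> f g; apply/funext => n; apply: addrC. Qed.
Fact series_add0 : left_id series_zero series_add.
Proof. by move=> f; apply/funext => n; apply: add0r. Qed.
Fact series_addN : left_inverse series_zero series_opp series_add.
Proof. by move=> f; apply/funext => n; apply: addNr. Qed.

HB.instance Definition _ := GRing.isZmodule.Build (series T)
  series_addA series_addC series_add0 series_addN.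

Definition series_one : series T := fun n => (n == 0%N)%:R.
Definition series_mul f g : series T := fun n =>
  \sum_(i < n.+1) f i * g (n - i)%N.

(** Commutativity and associativity are inherited from polynomials: a coefficient of a product
    depends only on the truncations of the factors up to its degree. *)
Let trunc N f : {poly T} := \poly_(i < N.+1) f i.

Let coef_trunc N f n : (n <= N)%N -> (trunc N f)`_n = f n.
Proof. by move=> nN; rewrite coef_poly ltnS nN. Qed.

Let coef_truncM N f g n : (n <= N)%N ->
  (trunc N f * trunc N g)`_n = series_mul f g n.
Proof.
move=> nN; rewrite coefM; apply: eq_bigr => i _.
by rewrite !coef_trunc //; have := ltn_ord i; lia.
Qed.

Fact series_mulC : commutative series_mul.
Proof.
by move=> f g; apply/funext => n; rewrite -!(coef_truncM _ _ (leqnn n)) mulrC.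
Qed.

Fact series_mulA : associative series_mul.
Proof.
move=> f g h; apply/funext => n.
transitivity ((trunc n f * (trunc n g * trunc n h))`_n).
  rewrite coefM; apply: eq_bigr => i _.
  by rewrite coef_trunc ?coef_truncM //; have := ltn_ord i; lia.
rewrite mulrA coefM; apply: eq_bigr => i _.
by rewrite coef_trunc ?coef_truncM //; have := ltn_ord i; lia.
Qed.

Fact series_mul1 : left_id series_one series_mul.
Proof.
move=> f; apply/funext => n; rewrite /series_mul big_ord_recl mul1r subn0.
by rewrite big1 ?addr0 // => i _; rewrite mul0r.
Qed.

Fact series_mulDl : left_distributive series_mul series_add.
Proof.
move=> f g h; apply/funext => n; rewrite /series_mul /series_add -big_split /=.
by apply: eq_bigr => i _; rewrite mulrDl.
Qed.

Fact series_one_neq0 : series_one != 0.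
Proof.
by apply/eqP => /(congr1 (fun f : series T => f 0%N)) /eqP; rewrite oner_eq0.
Qed.

HB.instance Definition _ := GRing.Zmodule_isComNzRing.Build (series T)
  series_mulA series_mulC series_mul1 series_mulDl series_one_neq0.

Lemma coef_sum (I : Type) (r : seq I) (P : pred I) (F : I -> series T) n :
  (\sum_(i <- r | P i) F i) n = \sum_(i <- r | P i) F i n.
Proof. by apply: (big_morph (fun f : series T => f n)). Qed.

End SeriesRing.

(** * Two-variable series and the embeddings of one-variable series *)

Section TwoVariables.
Variable C : fieldType.
Implicit Types (f g : series C) (F G : series (series C)).

Lemma fps2_mulE F G : fps2_mul F G = F * G.
Proof.
apply/funext => m; apply/funext => n; rewrite /GRing.mul /= /series_mul.
by rewrite coef_sum.
Qed.

Lemma fps2_addE F G : fps2_add F G = F + G.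
Proof. by []. Qed.

Definition emb_z f : series (series C) := in_z f.
Definition emb_w f : series (series C) := in_w f.

Lemma coef_emb_z f m F n : (emb_z f * F) m n = \sum_(i < m.+1) f i * F (m - i)%N n.
Proof.
rewrite -fps2_mulE /fps2_mul; apply: eq_bigr => i _.
rewrite big_ord_recl /emb_z /in_z /= subn0 big1 ?addr0 // => j _.
by rewrite mul0r.
Qed.

Lemma coef_emb_w f m F n : (emb_w f * F) m n = \sum_(j < n.+1) f j * F m (n - j)%N.
Proof.
rewrite -fps2_mulE /fps2_mul big_ord_recl /= subn0 [X in _ + X]big1 ?addr0 // => i _.
by rewrite big1 // => j _; rewrite /emb_w /in_w mul0r.
Qed.

Lemma emb_zM f g : emb_z (f * g) = emb_z f * emb_z g.
Proof.
apply/funext => m; apply/funext => n; rewrite coef_emb_z /emb_z /in_z.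
by case: eqP => // _; rewrite big1 // => i _; rewrite mulr0.
Qed.

Lemma emb_wM f g : emb_w (f * g) = emb_w f * emb_w g.
Proof.
apply/funext => m; apply/funext => n; rewrite coef_emb_w /emb_w /in_w.
by case: eqP => // _; rewrite big1 // => i _; rewrite mulr0.
Qed.

Lemma emb_z1 : emb_z 1 = 1.
Proof.
apply/funext => m; apply/funext => n; rewrite /emb_z /in_z.
rewrite /GRing.one /= /series_one.
by case: m => [|m]; case: n.
Qed.

Lemma emb_w1 : emb_w 1 = 1.
Proof.
apply/funext => m; apply/funext => n; rewrite /emb_w /in_w.
rewrite /GRing.one /= /series_one.
by case: m => [|m]; case: n.
Qed.

(** Both sums are reversed so that the summation indices become the exponents of [F], as they are
    for the powers in [power_sum]. *)
Lemma coef_emb_zw f g F m n : (emb_z f * emb_w g * F) m n =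
  \sum_(i < m.+1) \sum_(j < n.+1) f (m - i)%N * g (n - j)%N * F i j.
Proof.
rewrite -mulrA coef_emb_z (reindex_inj rev_ord_inj) /=; apply: eq_bigr => i _.
rewrite subSS subKn; last by rewrite -ltnS.
rewrite coef_emb_w (reindex_inj rev_ord_inj) mulr_sumr /=; apply: eq_bigr => j _.
by rewrite subSS subKn ?mulrA // -ltnS.
Qed.

End TwoVariables.

(** * Interval partitions *)

Section IntervalPartitions.
Variables (C : fieldType) (T : finType) (N : nat) (key : T -> nat).
Hypotheses (key_inj : injective key) (key_lt : forall i, (key i < N)%N)
  (key_surj : forall k, (k < N)%N -> exists i, key i = k).
Variable f : {set T} -> C.

Definition convex (V : {set T}) : bool :=
  [forall i in V, forall k in V, forall j,
     ((key i < key j)%N && (key j < key k)%N) ==> (j \in V)].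

Definition segment (k l : nat) : {set T} := [set i | (k <= key i < l)%N].

Definition convex_partition (D : {set T}) (P : {set {set T}}) : bool :=
  partition P D && [forall V in P, convex V].

(** At k = 0, and for the order of [chi_mn], this is the right side of the moment-cumulant formula;
    a larger k describes what remains once initial blocks are split off. *)
Definition tail_sum (k : nat) : C :=
  \sum_(P : {set {set T}} | convex_partition (segment k N) P) \prod_(V in P) f V.

Let convexP (V : {set T}) i j k : convex V -> i \in V -> k \in V ->
  (key i <= key j <= key k)%N -> j \in V.
Proof.
move=> /forall_inP h iV kV hj.
have [e|n1] := eqVneq (key i) (key j); first by rewrite -(key_inj e).
have [e|n2] := eqVneq (key j) (key k); first by rewrite (key_inj e).
have /forall_inP/(_ k kV)/forallP/(_ j)/implyP := h i iV; apply; lia.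
Qed.

Let convex_segment k l : convex (segment k l).
Proof.
apply/forall_inP => i; rewrite inE => hi; apply/forall_inP => j; rewrite inE => hj.
by apply/forallP => t; apply/implyP; rewrite inE; lia.
Qed.

Let initial_segmentP (x0 : T) (V : {set T}) :
  reflect (exists2 l, (key x0 < l <= N)%N & V = segment (key x0) l)
    [&& x0 \in V, V \subset segment (key x0) N & convex V].
Proof.
apply: (iffP and3P) => [[xV /subsetP sV cV]|[l hl ->]]; last first.
  split; [by rewrite inE; lia| |exact: convex_segment].
  by apply/subsetP => i; rewrite !inE; lia.
(* The right end is one past the largest key in [V]; convexity fills in everything between. *)
have [i iV imax] := arg_maxnP key xV.
exists (key i).+1; first by have := key_lt i; have := sV i iV; rewrite inE; lia.
apply/setP => j; rewrite inE; apply/idP/idP => [jV|hj].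
  by have := sV j jV; have := imax j jV; rewrite inE; lia.
by apply: (convexP cV xV iV); lia.
Qed.

Let segment_inj k l l' : (k < l <= N)%N -> (k < l' <= N)%N ->
  segment k l = segment k l' -> l = l'.
Proof.
have aux a b : (k < a)%N -> (b <= N)%N -> (a < b)%N -> segment k a <> segment k b.
  move=> h1 h2 h3 /setP e.
  have [|i hi] := @key_surj a; first by lia.
  by have := e i; rewrite !inE hi; lia.
move=> h h' e; case: (ltngtP l l') => // hl.
  by case: (aux l l'); lia || done.
by case: (aux l' l); rewrite // ?e; lia.
Qed.

(** Justifies the reindexing that removes the first block: the equality in the condition says that
    the segment is not already in [P]. *)
Let convex_partition_cons k l P : (k < l <= N)%N ->
  convex_partition (segment k N) (segment k l |: P) &&
    ((segment k l |: P) :\ segment k l == P) =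
  convex_partition (segment l N) P.
Proof.
move=> hl; have eD : segment k N :\: segment k l = segment l N.
  by apply/setP => i; rewrite !inE; lia.
have eU : segment k l :|: segment l N = segment k N.
  apply/setP => i; rewrite !inE; have := key_lt i; lia.
apply/idP/idP.
  move=> /andP[/andP[hP /forall_inP hc] /eqP eP]; apply/andP; split.
    by rewrite -eP -eD; apply: partitionD1; rewrite // inE set11.
  by apply/forall_inP => V VP; apply: hc; rewrite inE VP orbT.
move=> /andP[hP /forall_inP hc]; rewrite setU1K; last first.
  apply/negP => SP; have [|i hi] := @key_surj k; first by lia.
  by have /subsetP/(_ i) := partitionS hP SP; rewrite !inE hi; lia.
rewrite eqxx andbT; apply/andP; split.
  rewrite -eU; apply: partitionU1 => //.
    have [|i hi] := @key_surj k; first by lia.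
    by apply/set0Pn; exists i; rewrite inE hi; lia.
  by rewrite -setI_eq0; apply/eqP/setP => i; rewrite !inE; lia.
apply/forall_inP => V; rewrite in_setU1 => /orP[/eqP ->|]; last exact: hc.
exact: convex_segment.
Qed.

Lemma tail_sum_end : tail_sum N = 1.
Proof.
have e : segment N N = set0 by apply/setP => i; rewrite !inE; lia.
rewrite /tail_sum (big_pred1 set0) => [|P]; first by rewrite big_set0.
rewrite /convex_partition e partition_set0 /=; case: eqP => //= ->.
by apply/forall_inP => V; rewrite inE.
Qed.

(* Splits off the block containing the first element. *)
Lemma tail_sum_rec k : (k < N)%N ->
  tail_sum k = \sum_(k.+1 <= l < N.+1) f (segment k l) * tail_sum l.
Proof.
move=> kN; have [x0 ex0] := key_surj kN.
pose first_blocks := [pred V : {set T} | [&& x0 \in V, V \subset segment k N & convex V]].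
rewrite /tail_sum (partition_big (fun P => pblock P x0) first_blocks) /=; last first.
  move=> P /andP[hP /forall_inP hc].
  have xP : x0 \in cover P by rewrite (cover_partition hP) inE; lia.
  by rewrite mem_pblock xP (partitionS hP) ?hc ?pblock_mem.
(* A possible block of [x0] is determined by its right end [l], so the blocks are enumerated by
   [l]. *)
pose s : seq {set T} := [seq segment k l | l <- index_iota k.+1 N.+1].
have us : uniq s.
  rewrite map_inj_in_uniq ?iota_uniq // => l l'; rewrite !mem_index_iota => h h'.
  by apply: segment_inj; lia.
have es (V : {set T}) : first_blocks V = (V \in s).
  rewrite /= -ex0; apply/initial_segmentP/mapP.
    by move=> [l hl ->]; exists l; rewrite ?mem_index_iota -?ex0 //; lia.
  by move=> [l]; rewrite mem_index_iota ex0 => hl ->; exists l => //; lia.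
rewrite (eq_bigl _ _ es) -big_uniq //= big_map big_seq [RHS]big_seq.
apply: eq_bigr => l; rewrite mem_index_iota => hl.
rewrite (reindex_onto (fun P => segment k l |: P)
  (fun P => P :\ segment k l)); last first.
  move=> P /andP[/andP[hP _] /eqP <-]; apply/setD1K/pblock_mem.
  by rewrite (cover_partition hP) inE; lia.
rewrite mulr_sumr; apply: eq_big => [P|P].
  rewrite -(@convex_partition_cons k l P); last by lia.
  rewrite -andbA; have [E|//] := boolP (convex_partition _ (segment k l |: P)).
  have /andP[hP _] := E.
  suff -> : pblock (segment k l |: P) x0 = segment k l by rewrite eqxx.
  apply: (def_pblock (partition_trivIset hP)); rewrite !inE ?eqxx //; lia.
move=> /andP[/andP[hP _] /eqP eP]; rewrite big_setU1 // -eP !inE eqxx //.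
Qed.

End IntervalPartitions.

(** * Moments and cumulants *)

(* The position of [i] for the order [chi_lt (chi_mn m n)]. *)
Definition chi_key m n (i : 'I_(m + n)) : nat :=
  if (i < m)%N then nat_of_ord i else ((2 * m + n).-1 - i)%N.

Lemma chi_key_inj m n : injective (@chi_key m n).
Proof.
move=> i j; rewrite /chi_key; have := ltn_ord i; have := ltn_ord j => hi hj.
by case: ifP; case: ifP => h1 h2 h; apply: val_inj => /=; lia.
Qed.

Lemma chi_key_lt m n (i : 'I_(m + n)) : (chi_key i < m + n)%N.
Proof. by rewrite /chi_key; have := ltn_ord i; case: ifP; lia. Qed.

Lemma chi_key_surj m n k : (k < m + n)%N -> exists i : 'I_(m + n), chi_key i = k.
Proof.
move=> h; have h' : ((if k < m then k else (2 * m + n).-1 - k) < m + n)%N.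
  by case: ifP; lia.
by exists (Ordinal h'); rewrite /chi_key /=; case: (ltnP k m) => hk; case: ifP; lia.
Qed.

Lemma chi_lt_key m n (i j : 'I_(m + n)) :
  chi_lt (chi_mn m n) i j = (chi_key i < chi_key j)%N.
Proof.
rewrite /chi_lt /chi_key !ffunE; have := ltn_ord i; have := ltn_ord j.
by case: (ltnP i m); case: (ltnP j m); lia.
Qed.

Lemma card_ord_range N a b : #|[set i : 'I_N | (a <= i < b)%N]| = (minn b N - a)%N.
Proof.
rewrite -sum1_card (eq_bigl (fun i : 'I_N => true && (a <= i < b)%N)); last first.
  by move=> i; rewrite inE.
rewrite -(big_mkord (fun i => true && (a <= i < b)%N) (fun=> 1%N)).
rewrite big_mkcond /=.
elim: N => [|N IH]; first by rewrite big_geq //; lia.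
by rewrite big_nat_recr //= IH; case: ifP; lia.
Qed.

Lemma enum_val_lt N (V : {set 'I_N}) (s t : 'I_#|V|) :
  (s < t)%N -> (enum_val s < enum_val t)%N.
Proof.
move=> st; have srt : sorted ltn (map val (enum V)).
  rewrite sorted_map [enum V]/enum_mem -enumT; apply: sorted_filter.
    by move=> a b c; apply: ltn_trans.
  by have := iota_ltn_sorted 0 N; rewrite -val_enum_ord sorted_map.
rewrite (enum_val_nth (enum_val s)) (enum_val_nth (enum_val s) t).
have hs : (s < size (enum V))%N by rewrite -cardE.
have ht : (t < size (enum V))%N by rewrite -cardE.
rewrite -!(nth_map (enum_val s) (val (enum_val s)) val) //.
apply: (sorted_ltn_nth ltn_trans) => //; by rewrite inE size_map.
Qed.

Section Restriction.
Variables (N m : nat) (V : {set 'I_N}).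

Lemma card_split_at : #|V| =
  (#|[set i in V | (i < m)%N]| + #|[set i in V | (m <= i)%N]|)%N.
Proof.
rewrite -(cardsID [set i : 'I_N | (i < m)%N] V); congr (_ + _)%N; apply: eq_card => i;
  by rewrite !inE -?leqNgt // andbC.
Qed.

(** Since [enum_val] is increasing, the values below [m] occupy an initial range of positions. Hence
    [chi_mn] restricted to a block is again of the form [chi_mn]. *)
Lemma enum_val_lt_card (t : 'I_#|V|) :
  (enum_val t < m)%N = (t < #|[set i in V | (i < m)%N]|)%N.
Proof.
have -> : #|[set i in V | (i < m)%N]| = #|[set s : 'I_#|V| | (enum_val s < m)%N]|.
  rewrite -(card_imset _ enum_val_inj); apply: eq_card => i; rewrite inE.
  apply/andP/imsetP => [[iV im]|[s]]; last by rewrite inE => hs ->; rewrite enum_valP.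
  by exists (enum_rank_in iV i); rewrite ?inE enum_rankK_in.
apply/idP/idP => h.
  have <- : #|[set s : 'I_#|V| | (0 <= s < t.+1)%N]| = t.+1.
    by rewrite card_ord_range; have := ltn_ord t; lia.
  apply/subset_leq_card/subsetP => s; rewrite !inE => hs.
  have [/enum_val_lt st|ts|/val_inj -> //] := ltngtP s t; last by lia.
  exact: ltn_trans st h.
rewrite ltnNge; apply: contraTN h => h; rewrite -leqNgt.
have <- : #|[set s : 'I_#|V| | (0 <= s < t)%N]| = t.
  by rewrite card_ord_range; have := ltn_ord t; lia.
apply/subset_leq_card/subsetP => s; rewrite !inE => hs.
have [//|/enum_val_lt ts|/val_inj e] := ltngtP s t; last by rewrite e in hs; lia.
by have := ltn_trans ts hs; lia.
Qed.

End Restriction.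

(** * Recursion for the joint moments of two elements *)

Section MomentRecursion.
Variables (C : fieldType) (A : algType C) (phi : {scalar A}).
Variables (B : functional_family A) (hB : is_lr_cumulants phi B) (x y : A).

(** The arity is a separate variable because the cardinal of a block equals i + j only
    propositionally. *)
Lemma eq_B_mn N i j (chi : {ffun 'I_N -> side}) (u : {ffun 'I_N -> A}) :
    N = (i + j)%N -> (forall t, chi t = if (t < i)%N then Left else Right) ->
    (forall t, u t = if (t < i)%N then x else y) ->
  B chi u = B_mn B x y i j.
Proof.
move=> e; subst N => h1 h2; rewrite /B_mn; congr (B _ _); apply/ffunP => t;
by rewrite ?h1 ?h2 ffunE.
Qed.

Lemma B_restr m n (V : {set 'I_(m + n)}) :
  B (restr (chi_mn m n) V) (restr (args_mn m n x y) V) =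
  B_mn B x y #|[set i in V | (i < m)%N]| #|[set i in V | (m <= i)%N]|.
Proof.
by apply: eq_B_mn => [|t|t]; rewrite -?card_split_at // !ffunE enum_val_lt_card.
Qed.

Lemma B_mn0 m : B_mn B x y m 0 = B_m B x m.
Proof.
symmetry; apply: eq_B_mn => [|t|t]; by rewrite ?addn0 // ffunE ltn_ord.
Qed.

Lemma prod_args_mn m n :
  \prod_(i < m + n) args_mn m n x y i = x ^+ m * y ^+ n.
Proof.
rewrite big_split_ord; congr (_ * _).
  rewrite (eq_bigr (fun=> x)) ?prodr_const ?card_ord // => i _.
  by rewrite ffunE /= ltn_ord.
rewrite (eq_bigr (fun=> y)) ?prodr_const ?card_ord // => i _.
by rewrite ffunE /= ifN // -leqNgt leq_addr.
Qed.

Let weight m n (V : {set 'I_(m + n)}) : C :=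
  B_mn B x y #|[set i in V | (i < m)%N]| #|[set i in V | (m <= i)%N]|.

Let weight_segment m n k l : (k < l <= m + n)%N ->
  weight (segment (@chi_key m n) k l) =
  B_mn B x y (minn l m - minn k m) ((l - m) - (k - m)).
Proof.
move=> hkl; rewrite /weight; congr (B_mn _ _ _ _ _).
  have -> : [set i in segment (@chi_key m n) k l | (i < m)%N] =
            [set i : 'I_(m + n) | (k <= i < minn l m)%N].
    by apply/setP => i; rewrite !inE /chi_key; case: ifP; have := ltn_ord i; lia.
  by rewrite card_ord_range; lia.
(* On right indices [chi_key] is the reflection i -> 2m + n - 1 - i, which gives these bounds. *)
have -> : [set i in segment (@chi_key m n) k l | (m <= i)%N] =
          [set i : 'I_(m + n) | (maxn m (2 * m + n - l) <= i < 2 * m + n - k)%N].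
  by apply/setP => i; rewrite !inE /chi_key; case: ifP; have := ltn_ord i; lia.
by rewrite card_ord_range; lia.
Qed.

Let tail m n := tail_sum (m + n) (@chi_key m n) (@weight m n).

Let moment_tail m n : (0 < m + n)%N -> phi (x ^+ m * y ^+ n) = tail m n 0.
Proof.
have [_ hB2] := hB; move=> mn0; rewrite -prod_args_mn (hB2 _ (chi_mn m n)) //.
apply: eq_big => [P|P _]; last first.
  by apply: eq_bigr => V _; rewrite B_restr.
rewrite /interval_partition /convex_partition; congr (partition _ _ && _).
  by apply/setP => i; rewrite !inE chi_key_lt.
apply: eq_forallb => V; congr (_ ==> _); rewrite /chi_interval /convex.
apply: eq_forallb => i; congr (_ ==> _); apply: eq_forallb => k; congr (_ ==> _).
by apply: eq_forallb => j; rewrite !chi_lt_key.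
Qed.

Let tail_rec m n k : (k < m + n)%N -> tail m n k =
  \sum_(k.+1 <= l < (m + n).+1)
     B_mn B x y (minn l m - minn k m) ((l - m) - (k - m)) * tail m n l.
Proof.
move=> hk; rewrite /tail tail_sum_rec //.
- by apply: eq_big_nat => l hl; rewrite weight_segment //; lia.
- exact: chi_key_inj.
- exact: chi_key_lt.
- exact: chi_key_surj.
Qed.

Let tail_end m n : tail m n (m + n) = 1.
Proof. exact: tail_sum_end. Qed.

(** Removing the first k positions leaves a row of the same shape: left letters go first, and right
    letters only when no left ones remain. Both sides satisfy the same recursion, so no partition
    has to be transported. *)
Let tail_shift m n k : (k <= m + n)%N ->
  tail m n k = tail (m - k) (minn n (m + n - k)) 0.
Proof.
have [N] := ubnP (m + n - k); elim: N m n k => // N IH m n k hN.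
set m' := (m - k)%N; set n' := minn _ _; move=> hk.
have emn : (m' + n' = m + n - k)%N by lia.
have [ek|nk] := eqVneq k (m + n)%N.
  have -> : m' = 0%N by lia.
  have -> : n' = 0%N by lia.
  by rewrite ek tail_end (tail_end 0 0).
rewrite !tail_rec ?emn; try lia.
rewrite -[k.+1]add1n big_addn.
have -> : ((m + n).+1 - k = (m + n - k).+1)%N by lia.
apply: eq_big_nat => l hl; congr (_ * _); first by congr (B_mn _ _ _ _ _); lia.
rewrite IH; [|lia|lia]; rewrite [RHS]IH; [|lia|lia].
by congr (tail _ _ _); lia.
Qed.

(** The first block either consists of i copies of [x], or takes all m copies of [x] together with j
    copies of [y]. *)
Lemma moment_rec m n : (0 < m + n)%N -> phi 1 = 1 ->
  phi (x ^+ m * y ^+ n) =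
    \sum_(1 <= i < m.+1) B_mn B x y i 0 * phi (x ^+ (m - i) * y ^+ n)
    + \sum_(1 <= j < n.+1) B_mn B x y m j * phi (y ^+ (n - j)).
Proof.
move=> mn0 phi1.
have tail0 m1 n1 : tail m1 n1 0 = phi (x ^+ m1 * y ^+ n1).
  case: (posnP (m1 + n1)) => [e|/moment_tail -> //].
  have -> : m1 = 0%N by lia.
  have -> : n1 = 0%N by lia.
  by rewrite (tail_end 0 0) expr0 mulr1 phi1.
rewrite moment_tail // tail_rec // (@big_cat_nat _ _ _ m.+1) //=; last by lia.
congr (_ + _).
  apply: eq_big_nat => l hl; rewrite tail_shift ?tail0; last by lia.
  congr (B_mn _ _ _ _ _ * _); [lia|lia|].
  by congr (phi (_ * _ ^+ _)); lia.
rewrite -[m.+1]add1n big_addn.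
have -> : ((m + n).+1 - m = n.+1)%N by lia.
apply: eq_big_nat => l hl; rewrite tail_shift ?tail0; last by lia.
congr (B_mn _ _ _ _ _ * _); [lia|lia|].
have -> : (m - (l + m) = 0)%N by lia.
by rewrite expr0 mul1r; congr (phi (_ ^+ _)); lia.
Qed.

End MomentRecursion.

(** * Moment series in terms of the eta-transforms *)

Section MomentSeries.
Variables (C : fieldType) (A : algType C) (phi : {scalar A}).
Hypothesis phi1 : phi 1 = 1.
Variables (B : functional_family A) (hB : is_lr_cumulants phi B).

Definition moment_series (x : A) : series C := fun m => phi (x ^+ m).
Definition joint_moment_series (x y : A) : series (series C) :=
  fun m n => phi (x ^+ m * y ^+ n).

Lemma moment_series_eta x :
  moment_series x = 1 + (eta_transform B x : series C) * moment_series x.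
Proof.
apply/funext => m; rewrite /moment_series.
case: m => [|m].
  rewrite -[RHS]/(1 + \sum_(i < 1) _) big_ord1 mul0r addr0 expr0 phi1 //.
rewrite -[RHS]/(0 + \sum_(i < m.+2) _) add0r big_ord_recl mul0r add0r.
(* The one-variable recursion is the joint one with y = 1 and n = 0. *)
rewrite -[x ^+ m.+1 in LHS]mulr1 -(expr0 1) (moment_rec hB) //.
rewrite [X in _ + X]big_geq // addr0 big_add1 /= big_mkord.
by apply: eq_bigr => i _; rewrite B_mn0 !expr0 mulr1.
Qed.

Lemma emb_zD (f g : series C) : emb_z (f + g) = emb_z f + emb_z g.
Proof.
apply/funext => m; apply/funext => n; rewrite /emb_z /in_z.
rewrite -[RHS]/((if n == 0%N then f m else 0) + (if n == 0%N then g m else 0)).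
by case: eqP => //; rewrite addr0.
Qed.

(** With J the joint series, [moment_rec] reads J = H_y + eta_x J + H_y E, where the lone H_y is the
    row m = 0. Multiplying by H_x, the inverse of 1 - eta_x, solves for J. *)
Lemma joint_moment_series_eta x y :
  joint_moment_series x y =
  emb_z (moment_series x) * emb_w (moment_series y) *
    (1 + (reduced_eta_transform B x y : series (series C))).
Proof.
set E : series (series C) := reduced_eta_transform B x y.
have Hz : emb_z (moment_series x) * (1 - emb_z (eta_transform B x)) = 1.
  have := congr1 (@emb_z C) (moment_series_eta x).
  rewrite emb_zD emb_zM emb_z1 => e.
  by rewrite mulrBr mulr1 {1}e; ring.
suff Hrec : joint_moment_series x y = emb_w (moment_series y) +
    emb_z (eta_transform B x) * joint_moment_series x y +
    emb_w (moment_series y) * E.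
  transitivity (emb_z (moment_series x) * (1 - emb_z (eta_transform B x)) *
     joint_moment_series x y); first by rewrite Hz mul1r.
  rewrite -!mulrA; congr (_ * _).
  by rewrite mulrBl mul1r {1}Hrec; ring.
apply/funext => m; apply/funext => n.
rewrite -[RHS]/(emb_w (moment_series y) m n +
  (emb_z (eta_transform B x) * joint_moment_series x y) m n +
  (emb_w (moment_series y) * E) m n).
rewrite coef_emb_z coef_emb_w /emb_w /in_w /joint_moment_series.
rewrite /E /reduced_eta_transform.
case: m => [|m].
  rewrite big_ord1 mul0r addr0 big1 => [|j _]; last by rewrite mulr0.
  by rewrite addr0 expr0 mul1r.
rewrite big_ord_recl mul0r !add0r.
rewrite (moment_rec hB) //; congr (_ + _).
  rewrite big_add1 /= big_mkord.
  by apply: eq_bigr => i _; rewrite B_mn0.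
(* The last term contains the coefficient of w^0 in [E], which is zero for the reduced transform. *)
rewrite big_ord_recr /= subnn mulr0 addr0.
rewrite big_add1 /= big_mkord (reindex_inj rev_ord_inj) /=.
apply: eq_bigr => j _; have hj := ltn_ord j.
rewrite [RHS]mulrC subn_gt0 hj; congr (B_mn _ _ _ _ _ * phi (_ ^+ _)); lia.
Qed.

End MomentSeries.

(** * Covariances under bi-Boolean independence *)

(* [big_enum_val] without commutativity. *)
Lemma prod_enum_val (R : pzRingType) (T : finType) (t0 : T) (V : {set T}) (x : T -> R) :
  \prod_(i < #|V|) x (enum_val i) = \prod_(j in V) x j.
Proof.
rewrite -big_filter [index_enum T]unlock -[filter _ _]/(enum V).
rewrite (big_nth t0) -cardE big_mkord.
by apply: eq_bigr => i _; rewrite (enum_val_nth t0).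
Qed.

Section FiberPartition.
Variables (m n : nat) (K : eqType) (omega : {ffun 'I_(m + n) -> K}).
Variable f : 'I_(m + n) -> 'I_(m + n).
Let P := preim_partition f [set: 'I_(m + n)].

(** For maximality, a monochromatic interval is traversed one position at a time; the third
    hypothesis keeps [f] constant on the way, so a coarser [Q] has the same blocks. *)
Lemma is_pi_omega_chi_fibers :
  (forall i j k, f i = f k -> (chi_key i < chi_key j < chi_key k)%N -> f j = f i) ->
  (forall i j, f i = f j -> omega i = omega j) ->
  (forall i j, chi_key j = (chi_key i).+1 -> omega i = omega j -> f i = f j) ->
  is_pi_omega_chi (chi_mn m n) omega P.
Proof.
move=> hconv hmono hmax.
have PP : partition P [set: 'I_(m + n)] by apply: preim_partitionP.
have Peq V i j : V \in P -> i \in V -> j \in V -> f i = f j.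
  case/imsetP => t _ ->; rewrite !inE /= => /eqP <- /eqP <- //.
have Pin V i j : V \in P -> i \in V -> f i = f j -> j \in V.
  by case/imsetP => t _ ->; rewrite !inE /= => /eqP -> ->.
split.
  apply/andP; split; first (apply/andP; split => //).
    apply/forall_inP => V VP; apply/forall_inP => i iV; apply/forall_inP => k kV.
    apply/forallP => j; apply/implyP; rewrite !chi_lt_key => hj.
    by apply: (Pin _ _ _ VP iV); rewrite (hconv i j k) // (Peq V i k).
  apply/forall_inP => V VP; apply/forall_inP => i iV; apply/forall_inP => k kV.
  by apply/eqP/hmono/(Peq V).
move=> Q /andP[/andP[QP /forall_inP Qconv] /forall_inP Qmono] /forall_inP PQ.
have Qeq W i j : W \in Q -> i \in W -> j \in W -> f i = f j.
  move=> WQ.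
  suff le d i' j' : i' \in W -> j' \in W ->
      chi_key j' = (chi_key i' + d)%N -> f i' = f j'.
    case: (leqP (chi_key i) (chi_key j)) => hij iW jW.
      by apply: (le (chi_key j - chi_key i)%N) => //; lia.
    by symmetry; apply: (le (chi_key i - chi_key j)%N) => //; lia.
  elim: d i' => [|d IH] i' iW jW e.
    by congr (f _); apply: chi_key_inj; rewrite e addn0.
  have [|s es] := @chi_key_surj m n (chi_key i').+1.
    by have := chi_key_lt j'; lia.
  have sW : s \in W.
    have [->|ns] := eqVneq s j'; first by [].
    have /forall_inP/(_ i' iW)/forall_inP/(_ j' jW)/forallP/(_ s)/implyP := Qconv W WQ.
    rewrite !chi_lt_key; apply; suff : chi_key s != chi_key j' by lia.
    by apply: contraNneq ns => /chi_key_inj ->.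
  rewrite -(IH s) //; last by lia.
  apply: hmax => //.
  by have /forall_inP/(_ i' iW)/forall_inP/(_ s sW)/eqP := Qmono W WQ.
rewrite -(equivalence_partition_pblock QP) /P /preim_partition /equivalence_partition.
apply: eq_imset => i; apply/setP => j; rewrite !inE /=.
have iQ : i \in cover Q by rewrite (cover_partition QP) inE.
apply/idP/eqP => [jW|e].
  by apply: (Qeq _ _ _ (pblock_mem iQ)); rewrite ?mem_pblock.
have iP : i \in cover P by rewrite (cover_partition PP) inE.
have VP := pblock_mem iP; have iV : i \in pblock P i by rewrite mem_pblock.
have [W WQ /subsetP VW] := exists_inP (PQ _ VP).
rewrite (def_pblock (partition_trivIset QP) WQ (VW _ iV)).
by apply/VW/(Pin _ _ _ VP iV).
Qed.

(** Idempotence gives each fibre exactly one fixed point, which serves as its index. *)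
Lemma phi_part_fibers (C : fieldType) (A : algType C) (phi : {scalar A})
    (x : {ffun 'I_(m + n) -> A}) : (forall i, f (f i) = f i) ->
  phi_part phi P x = \prod_(i | f i == i) phi (\prod_(j | f j == i) x j).
Proof.
move=> ff; rewrite /phi_part.
have -> : P = [set [set j | f j == i] | i in [pred i | f i == i]].
  apply/setP => V; apply/imsetP/imsetP => [[i _ ->]|[i /eqP fi ->]].
    by exists (f i); rewrite ?inE ?ff //; apply/setP => j; rewrite !inE eq_sym.
  by exists i => //; apply/setP => j; rewrite !inE fi eq_sym.
rewrite big_imset /= => [|i j /eqP fi /eqP fj /setP/(_ i)]; last first.
  by rewrite !inE fi eqxx => /esym/eqP.
apply: eq_bigr => i _; congr (phi _).
rewrite (eq_bigr (fun t => x (enum_val t))) => [|t _]; last by rewrite ffunE.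
rewrite (prod_enum_val i); apply: eq_bigl => j; by rewrite inE.
Qed.

End FiberPartition.

Section Words.
Variables (C : fieldType) (A : algType C) (phi : {scalar A}).
Variables (K : finType) (S : K -> side -> classical_sets.set A).
Hypotheses (phi1 : phi 1 = 1) (hS : bi_Boolean_independent phi S).
Implicit Types (us vs : seq (K * A)) (t : side).

(* A word is stored with its last letter first, so that the heads of a left
   word and of a right word are adjacent for the order [chi_lt]. *)
Definition word_prod us : A := \prod_(cu <- rev us) cu.2.
Definition word_phi us : C := \prod_(cu <- rev us) phi cu.2.

(** Runs of one colour are multiplied out into single letters, so neighbours within a word always
    lie in different blocks of pi. *)
Definition reduced_word t us : Prop :=
  (forall cu, cu \in us -> S cu.1 t cu.2) /\
  sorted (fun cu dv : K * A => cu.1 != dv.1) us.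

Lemma word_prod_cons cu us : word_prod (cu :: us) = word_prod us * cu.2.
Proof. by rewrite /word_prod rev_cons -cats1 big_cat big_seq1. Qed.

Lemma word_phi_cons cu us : word_phi (cu :: us) = word_phi us * phi cu.2.
Proof. by rewrite /word_phi rev_cons -cats1 big_cat big_seq1. Qed.

Let word_phi_behead d0 us : (0 < size us)%N ->
  \prod_(i < size us | val i != (size us).-1) phi (nth d0 (rev us) i).2 =
  word_phi (behead us).
Proof.
case: us => // cu us _; rewrite /= big_mkcond big_ord_recr /= eqxx mulr1.
rewrite /word_phi (big_nth d0) size_rev big_mkord; apply: eq_bigr => i _.
by rewrite ifT ?rev_cons ?nth_rcons ?size_rev ?ltn_ord // neq_ltn ltn_ord.
Qed.

Section TwoWords.
Variables (us vs : seq (K * A)) (d0 : K * A).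
Hypotheses (hus : reduced_word Left us) (hvs : reduced_word Right vs).
Let m := size us.
Let n := size vs.
(** All letters in the order of [chi_lt]; the two heads meet at positions m - 1 and m. *)
Let z := rev us ++ vs.
Let w (i : 'I_(m + n)) := nth d0 z (chi_key i).
Let omega := [ffun i => (w i).1].
Let x := [ffun i => (w i).2].

Let w_lshift (i : 'I_m) : w (lshift n i) = nth d0 (rev us) i.
Proof. by rewrite /w /chi_key /= ltn_ord nth_cat size_rev ltn_ord. Qed.

Let w_rshift (j : 'I_n) : w (rshift m j) = nth d0 (rev vs) j.
Proof.
have hj := ltn_ord j; rewrite /w /chi_key /= ifN; last by lia.
rewrite nth_cat size_rev ifN; last by rewrite -/m; lia.
by rewrite nth_rev //; congr (nth _ _ _); rewrite -/m -/n; lia.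
Qed.

Let big_us (T : Type) (idx : T) op (F : K * A -> T) :
  \big[op/idx]_(cu <- rev us) F cu = \big[op/idx]_(i < m) F (nth d0 (rev us) i).
Proof. by rewrite (big_nth d0) size_rev big_mkord. Qed.

Let big_vs (T : Type) (idx : T) op (F : K * A -> T) :
  \big[op/idx]_(cu <- rev vs) F cu = \big[op/idx]_(i < n) F (nth d0 (rev vs) i).
Proof. by rewrite (big_nth d0) size_rev big_mkord. Qed.

Let prod_x : \prod_(i < m + n) x i = word_prod us * word_prod vs.
Proof.
rewrite big_split_ord /word_prod big_us big_vs.
by congr (_ * _); apply: eq_bigr => i _; rewrite ffunE ?w_lshift ?w_rshift.
Qed.

Let mem_S i : S (omega i) (chi_mn m n i) (x i).
Proof.
rewrite !ffunE -(splitK i); case: (split i) => j /=.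
  by rewrite ltn_ord w_lshift; apply: hus.1; rewrite -mem_rev mem_nth ?size_rev.
rewrite ifN -?leqNgt ?leq_addr // w_rshift.
by apply: hvs.1; rewrite -mem_rev mem_nth ?size_rev.
Qed.

Let adjacent k : (k.+1 < m + n)%N -> k.+1 != m ->
  (nth d0 z k).1 != (nth d0 z k.+1).1.
Proof.
move=> hk km; rewrite !nth_cat size_rev -/m; case: (ltnP k m) => km'.
  rewrite ifT; last by lia.
  rewrite !nth_rev -/m; try lia.
  rewrite eq_sym (_ : m - k.+1 = (m - k.+2).+1)%N; last by lia.
  by have /(sortedP d0) := hus.2; apply; rewrite -/m; lia.
rewrite ifN; last by lia.
rewrite (_ : k.+1 - m = (k - m).+1)%N; last by lia.
by have /(sortedP d0) := hvs.2; apply; rewrite -/n; lia.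
Qed.

(** No neighbours in the row share a colour, so pi consists of singletons, the fibres of the
    identity. *)
Lemma phi_words_split :
  (forall cu us' dv vs', us = cu :: us' -> vs = dv :: vs' -> cu.1 != dv.1) ->
  phi (word_prod us * word_prod vs) = word_phi us * word_phi vs.
Proof.
move=> hne; case: (posnP (m + n)) => [e0|mn0].
  have /size0nil -> : size us = 0%N by rewrite -/m; lia.
  have /size0nil -> : size vs = 0%N by rewrite -/n; lia.
  by rewrite /word_prod /word_phi /= !big_nil !mulr1 phi1.
have hpi : is_pi_omega_chi (chi_mn m n) omega (preim_partition id setT).
  apply: is_pi_omega_chi_fibers => [i j k ->|i j ->|i j e] //; first by lia.
  move=> /eqP; rewrite !ffunE /w e; apply: contraTeq => _.
  have hj : ((chi_key i).+1 < m + n)%N by rewrite -e chi_key_lt.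
  move: (chi_key i) hj => k hj {e}.
  have [em|] := eqVneq k.+1 m; last exact: adjacent.
  rewrite !nth_cat size_rev -/m ifT ?ifN; try lia.
  rewrite nth_rev -/m; last by lia.
  rewrite em subnn; move: em hj hne; rewrite /m /n.
  case: us => [//|cu us']; case: vs => [|dv vs'] /=; first by lia.
  by move=> _ _ /(_ _ _ _ _ erefl erefl).
rewrite -prod_x (hS.2 _ _ _ _ _ mn0 mem_S hpi) phi_part_fibers //.
rewrite (eq_bigl predT) => [|i]; last by rewrite eqxx.
rewrite (eq_bigr (fun i => phi (x i))) => [|i _]; last by rewrite big_pred1_eq.
rewrite big_split_ord /word_phi big_us big_vs.
by congr (_ * _); apply: eq_bigr => i _; rewrite ffunE ?w_lshift ?w_rshift.
Qed.

(** The two heads are the only neighbours of equal colour, so they form the only block of pi that is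
    not a singleton. *)
Lemma phi_words_merge c u us' v vs' : us = (c, u) :: us' -> vs = (c, v) :: vs' ->
  phi (word_prod us * word_prod vs) = word_phi us' * phi (u * v) * word_phi vs'.
Proof.
move=> eus evs.
have [m0 n0] : (0 < m /\ 0 < n)%N by rewrite /m /n eus evs.
have lt_p : (m.-1 < m + n)%N by lia.
have lt_q : ((m + n).-1 < m + n)%N by lia.
(* [p] is the last left index; [q] is the last index of all, hence the first right one for [chi_lt].
   Sending [q] to [p] has the blocks of pi as fibres. *)
pose p := Ordinal lt_p; pose q := Ordinal lt_q.
pose f i := if i == q then p else i.
have key_p : chi_key p = m.-1 by rewrite /chi_key /= ifT; lia.
have key_q : chi_key q = m by rewrite /chi_key /= ifN; lia.
have pq : p != q by apply/eqP => /(congr1 val) /=; lia.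
have wp : w p = (c, u).
  rewrite /w key_p nth_cat size_rev ifT -/m; last by lia.
  have e0 : (m - m.-1.+1 = 0)%N by lia.
  by rewrite nth_rev -/m ?e0; [rewrite eus|lia].
have wq : w q = (c, v) by rewrite /w key_q nth_cat size_rev ltnn subnn evs.
have fx i : i != q -> f i = i by rewrite /f => /negPf ->.
have fq : f q = p by rewrite /f eqxx.
have ff i : f (f i) = f i.
  by have [->|h] := eqVneq i q; rewrite ?fq !fx.
have hpi : is_pi_omega_chi (chi_mn m n) omega (preim_partition f setT).
  apply: is_pi_omega_chi_fibers => [i j k|i j|i j e].
  - have [->|iq] := eqVneq i q; have [->|kq] := eqVneq k q.
    + by lia.
    + by rewrite fq (fx k) // => <-; lia.
    + by rewrite fq (fx i) // => ->; lia.
    by rewrite (fx i) // (fx k) // => ->; lia.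
  - have [->|iq] := eqVneq i q; have [->|jq] := eqVneq j q.
    + by [].
    + by rewrite fq fx // => <-; rewrite !ffunE wp wq.
    + by rewrite fq fx // => ->; rewrite !ffunE wp wq.
    by rewrite !fx // => ->.
  have [em _|em] := eqVneq (chi_key i).+1 m.
    have -> : i = p by apply: chi_key_inj; lia.
    have -> : j = q by apply: chi_key_inj; lia.
    by rewrite fq fx.
  move=> /eqP; rewrite !ffunE /w e; apply: contraTeq => _.
  by apply: adjacent => //; rewrite -e chi_key_lt.
rewrite -prod_x (hS.2 _ _ _ _ _ _ mem_S hpi) ?phi_part_fibers //; last by lia.
have fixE i : (f i == i) = (i != q).
  by have [->|iq] := eqVneq i q; rewrite ?fq ?fx ?eqxx // (negPf pq).
rewrite (eq_bigl _ _ fixE) (bigD1 p) //=.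
have fpE j : (f j == p) = (j == p) || (j == q).
  by have [->|jq] := eqVneq j q; rewrite ?fq ?fx ?eqxx ?orbT ?orbF.
have lt_m : (m.-1 < m)%N by lia.
have lt_n : (n.-1 < n)%N by lia.
have -> : \prod_(j | f j == p) x j = u * v.
  rewrite (eq_bigl _ _ fpE) big_split_ord.
  rewrite (big_pred1 (Ordinal lt_m)) => [|i]; last first.
    by have hi := ltn_ord i; rewrite /= -!val_eqE /=; lia.
  rewrite (big_pred1 (Ordinal lt_n)) => [|i]; last first.
    by have hi := ltn_ord i; rewrite /= -!val_eqE /=; lia.
  have -> : lshift n (Ordinal lt_m) = p by apply: val_inj.
  have -> : rshift m (Ordinal lt_n) = q by apply: val_inj => /=; lia.
  by rewrite !ffunE wp wq.
rewrite (eq_bigr (fun i => phi (x i))) => [|i /andP[iq ip]]; last first.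
  rewrite (big_pred1 i) // => j /=; have [->|jq] := eqVneq j q; rewrite ?fq ?fx //.
  by rewrite ![_ == i]eq_sym (negPf iq) (negPf ip).
rewrite mulrAC mulrC; congr (_ * _).
rewrite big_split_ord.
have -> : us' = behead us by rewrite eus.
have -> : vs' = behead vs by rewrite evs.
rewrite -(word_phi_behead d0 m0) -(word_phi_behead d0 n0).
congr (_ * _); apply: eq_big => [i|i _]; rewrite ?ffunE ?w_lshift ?w_rshift //;
  by have hi := ltn_ord i; rewrite -!val_eqE /= -/m -/n; lia.
Qed.

End TwoWords.
Lemma word_phi_nil : word_phi [::] = 1.
Proof. by rewrite /word_phi big_nil. Qed.

Lemma word_prod_nil : word_prod [::] = 1.
Proof. by rewrite /word_prod big_nil. Qed.

Lemma reduced_nil t : reduced_word t [::].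
Proof. by []. Qed.

Lemma phi_word t us : reduced_word t us -> phi (word_prod us) = word_phi us.
Proof.
case: us => [|cu us] h; first by rewrite word_prod_nil word_phi_nil.
case: t h => h.
  have := phi_words_split cu h (reduced_nil Right).
  by rewrite word_prod_nil word_phi_nil !mulr1; apply.
have := phi_words_split cu (reduced_nil Left) h.
by rewrite word_prod_nil word_phi_nil !mul1r; apply.
Qed.

(** * Covariances and their decomposition by colours *)

Definition covariance (p r : A) : C := phi (p * r) - phi p * phi r.

Lemma covariance_linl k p q r :
  covariance (k *: p + q) r = k * covariance p r + covariance q r.
Proof. by rewrite /covariance mulrDl -scalerAl !linearP /=; ring. Qed.

Lemma covariance_linr k p q r :
  covariance p (k *: q + r) = k * covariance p q + covariance p r.
Proof. by rewrite /covariance mulrDr -scalerAr !linearP /=; ring. Qed.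

Lemma covariance_scalarl k r : covariance k%:A r = 0.
Proof. by rewrite /covariance -scalerAl mul1r !linearZ /= phi1; ring. Qed.

Lemma covariance_scalarr k p : covariance p k%:A = 0.
Proof. by rewrite /covariance -scalerAr mulr1 !linearZ /= phi1; ring. Qed.

Lemma covarianceZ k l p r :
  covariance (k *: p) (l *: r) = k * l * covariance p r.
Proof. by rewrite /covariance -scalerAl -scalerAr !linearZ /=; ring. Qed.

(* A conditional expectation onto the algebra of colour [c]: only the letter in
   contact with the other side is kept, and only if it has colour [c]. *)
Definition proj_word (c : K) us : A :=
  if us is cu :: us' then
    if cu.1 == c then word_phi us' *: cu.2 else (word_phi us)%:A
  else 1.

Lemma proj_word_scalar c us :
  (if us is cu :: _ then cu.1 != c else true) -> proj_word c us = (word_phi us)%:A.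
Proof.
case: us => [|cu us] /=; first by rewrite word_phi_nil scale1r.
by move=> /negPf ->.
Qed.

Lemma phi_proj_word c us : phi (proj_word c us) = word_phi us.
Proof.
case: us => [|cu us] /=; first by rewrite phi1 word_phi_nil.
by case: ifP => _; rewrite linearZ /= ?phi1 ?mulr1 // word_phi_cons.
Qed.

(** A covariance with a scalar vanishes. If the heads differ in colour, every colour has a scalar
    projection on one side; if they agree, only their common colour contributes, by
    [phi_words_merge]. *)
Lemma covariance_words us vs : reduced_word Left us -> reduced_word Right vs ->
  covariance (word_prod us) (word_prod vs) =
  \sum_c covariance (proj_word c us) (proj_word c vs).
Proof.
move=> hus hvs; rewrite {1}/covariance (phi_word hus) (phi_word hvs).
case: us hus => [|[c u] us] hus.
  rewrite word_prod_nil word_phi_nil !mul1r (phi_word hvs) subrr big1 // => c _.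
  by rewrite (proj_word_scalar (us := [::])) // covariance_scalarl.
case: vs hvs => [|[d v] vs] hvs.
  rewrite word_prod_nil word_phi_nil !mulr1 (phi_word hus) subrr big1 // => e _.
  by rewrite (proj_word_scalar (us := [::])) // covariance_scalarr.
have [ecd|ncd] := eqVneq c d; last first.
  rewrite (phi_words_split (c, u) hus hvs) => [|? ? ? ? [<- _] [<- _]] //.
  rewrite subrr big1 // => e _; have [ece|nce] := eqVneq c e.
    by rewrite (proj_word_scalar (us := _ :: vs)) ?covariance_scalarr //= -ece eq_sym.
  by rewrite (proj_word_scalar (us := _ :: us)) ?covariance_scalarl.
subst d; rewrite (phi_words_merge (c, u) hus hvs erefl erefl) (bigD1 c) //=.
rewrite eqxx big1 => [|e nec]; last first.
  by rewrite eq_sym (negPf nec) covariance_scalarl.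
by rewrite covarianceZ /covariance !word_phi_cons /=; ring.
Qed.

(* The linear extension of [word_prod us |-> (proj_word c us)_c], as a relation:
   distinct words may have the same product in [A]. *)
Inductive projections t : A -> (K -> A) -> Prop :=
| projections_word us : reduced_word t us ->
    projections t (word_prod us) (fun c => proj_word c us)
| projections_lin k p q P Q : projections t p P -> projections t q Q ->
    projections t (k *: p + q) (fun c => k *: P c + Q c).

Lemma projections1 t : projections t 1 (fun=> 1).
Proof. by have := projections_word (reduced_nil t); rewrite word_prod_nil. Qed.

Lemma phi_projections t p P c : projections t p P -> phi p = phi (P c).
Proof.
elim=> [us hus|k {}p q {}P Q _ e1 _ e2]; first by rewrite phi_proj_word (phi_word hus).
by rewrite !linearP e1 e2.
Qed.

Lemma covariance_projections p r P R :
  projections Left p P -> projections Right r R ->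
  covariance p r = \sum_c covariance (P c) (R c).
Proof.
move=> hp hr; elim: hp => [us hus|k {}p q {}P Q _ e1 _ e2]; last first.
  rewrite covariance_linl e1 e2 mulr_sumr -big_split /=.
  by apply: eq_bigr => c _; rewrite covariance_linl.
elim: hr => [vs hvs|k {}r q {}R Q _ e1 _ e2]; first exact: covariance_words.
rewrite covariance_linr e1 e2 mulr_sumr -big_split /=.
by apply: eq_bigr => c _; rewrite covariance_linr.
Qed.

(** On a word, [u] becomes a new head, or is absorbed into a head of colour [c] to keep the word
    reduced. The resulting head has colour [c], so all other projections become scalars. *)
Lemma projections_mul t p P c u : projections t p P -> S c t u ->
  projections t (p * u) (fun d => if d == c then P c * u else (phi (P c * u))%:A).
Proof.
move=> hp Su; elim: hp => [us hus|k {}p q {}P Q _ e1 _ e2]; last first.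
  rewrite mulrDl -scalerAl; have := projections_lin k e1 e2.
  congr (projections _ _ _); apply/funext => d; case: ifP => _.
    by rewrite mulrDl -scalerAl.
  by rewrite mulrDl -scalerAl linearP scalerDl scalerA.
have extend : (if us is cu :: _ then cu.1 != c else true) ->
    projections t (word_prod us * u)
      (fun d => if d == c then proj_word c us * u else (phi (proj_word c us * u))%:A).
  move=> hc; have hr : reduced_word t ((c, u) :: us).
    split; last by case: us hus hc => [|cu us] [_ /=] // -> ; rewrite eq_sym => ->.
    by move=> cu; rewrite inE => /orP[/eqP -> //|]; apply: hus.1.
  have := projections_word hr; rewrite word_prod_cons; congr (projections _ _ _).
  apply/funext => d; rewrite (proj_word_scalar hc) /= eq_sym -scalerAl mul1r.
  by case: ifP => // _; rewrite word_phi_cons linearZ.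
case: us hus extend => [|[d v] us] hus; first by apply.
have [edc _|ndc] := eqVneq d c; last by apply.
subst d; have hr : reduced_word t ((c, v * u) :: us).
  split; last by case: hus => _; case: us.
  move=> cu; rewrite inE => /orP[/eqP -> /=|h]; last by apply: hus.1; rewrite inE h orbT.
  have [_ _ Smul] := hS.1 c t; apply: Smul => //.
  by apply: (hus.1 (c, v)); rewrite inE eqxx.
have := projections_word hr; rewrite !word_prod_cons /= mulrA.
congr (projections _ _ _); apply/funext => d /=.
rewrite eqxx eq_sym -scalerAl; case: ifP => // _.
by rewrite word_phi_cons linearZ.
Qed.

Lemma projections_mul1D t p P c u : projections t p P -> S c t u ->
  projections t (p * (1 + u))
    (fun d => if d == c then P c * (1 + u) else P d + (phi (P c * u))%:A).
Proof.
move=> hp Su; rewrite mulrDr mulr1 -[X in X + _]scale1r.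
have := projections_lin 1 hp (projections_mul hp Su).
congr (projections _ _ _); apply/funext => d; rewrite scale1r.
by case: eqP => // ->; rewrite mulrDr mulr1.
Qed.

End Words.

(** * Powers of a product *)

Section Powers.
Variables (C : fieldType) (A : algType C) (phi : {scalar A}).
Variables (K : finType) (S : K -> side -> classical_sets.set A).
Hypotheses (phi1 : phi 1 = 1) (hS : bi_Boolean_independent phi S).

(** The coefficient of z^m in f(z) / (1 - z p). *)
Definition power_sum (f : series C) (p : A) (m : nat) : A :=
  \sum_(i < m.+1) f (m - i)%N *: p ^+ i.

Lemma phi_power_sum f p m : phi (power_sum f p m) = (moment_series phi p * f) m.
Proof.
rewrite linear_sum; apply: eq_bigr => i _.
by rewrite linearZ /= mulrC.
Qed.

Lemma power_sumS f p m :
  power_sum f p m.+1 = power_sum f p m * p + (f m.+1)%:A.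
Proof.
rewrite /power_sum big_ord_recl subn0 expr0 addrC mulr_suml; congr (_ + _).
by apply: eq_bigr => i _; rewrite exprSr scalerAl.
Qed.

Lemma power_sum0 f p : power_sum f p 0 = (f 0%N)%:A.
Proof. by rewrite /power_sum big_ord1 expr0. Qed.

Definition covariance_series (p r : A) : series (series C) :=
  fun m n => covariance phi (p ^+ m) (r ^+ n).

(** The scalar terms drop out of the covariance, and bilinearity turns the two power sums into a
    product of series. *)
Lemma covariance_power_sum f g p r m n k l :
  covariance phi (power_sum f p m + k%:A) (power_sum g r n + l%:A) =
  (emb_z f * emb_w g * covariance_series p r) m n.
Proof.
have suml (I : finType) (F : I -> C) (P : I -> A) q :
    covariance phi (\sum_i F i *: P i + k%:A) q = \sum_i F i * covariance phi (P i) q.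
  elim/big_rec2: _ => [|i s1 s2 _ <-]; first by rewrite add0r covariance_scalarl.
  by rewrite -addrA covariance_linl.
have sumr (I : finType) (F : I -> C) (P : I -> A) q :
    covariance phi q (\sum_i F i *: P i + l%:A) = \sum_i F i * covariance phi q (P i).
  elim/big_rec2: _ => [|i s1 s2 _ <-]; first by rewrite add0r covariance_scalarr.
  by rewrite -addrA covariance_linr.
rewrite coef_emb_zw suml; apply: eq_bigr => i _; rewrite sumr mulr_sumr.
by apply: eq_bigr => j _; rewrite mulrA.
Qed.

Section Product.
Variables (t : side) (c1 c2 : K) (e1 e2 : A).
Hypotheses (c12 : c1 != c2) (Se1 : S c1 t e1) (Se2 : S c2 t e2).
Let x := (1 + e1) * (1 + e2).
Let H : series C := moment_series phi x.
Let H1 : series C := moment_series phi (1 + e1).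
Let H2 : series C := moment_series phi (1 + e2).
(* The coefficients of [F] and [G] are forced by the value of [phi] on the
   projections of the powers of [x]. *)
Let F : series C := fun m =>
  if m is m'.+1 then phi (x ^+ m) - phi (x ^+ m' * (1 + e1)) else 1.
Let T : series C := fun m => phi (x ^+ m * e1).
Let G : series C := 1 + T.

(** The factor 1 + e1 adds the scalar [T m] to the second projection, cancelling its correction
    term; the factor 1 + e2 then multiplies that projection and adds a scalar to the first. *)
Lemma projections_power m : exists2 P, projections phi S t (x ^+ m) P &
  P c1 = power_sum F (1 + e1) m /\ P c2 = power_sum G (1 + e2) m + (- T m)%:A.
Proof.
elim: m => [|m [P hP [P1 P2]]].
  exists (fun=> 1); first by rewrite expr0; apply: projections1.
  rewrite !power_sum0 scale1r -scalerDl; split=> //.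
  by rewrite -[G 0%N]/(1 + T 0%N) addrK scale1r.
have h1 := projections_mul1D hS hP Se1.
have h2 := projections_mul1D hS h1 Se2.
have hT : phi (P c1 * e1) = T m.
  have := projections_mul hS hP Se1 => /(phi_projections phi1 hS c1 (p := _)).
  by rewrite eqxx.
move: h1 h2; rewrite /= [c2 == c1]eq_sym (negPf c12) hT P2.
rewrite -addrA -scalerDl addNr scale0r addr0 => h1 h2.
rewrite exprSr /x mulrA; eexists; first exact: h2.
rewrite /= eqxx (negPf c12) !eqxx; split; last first.
  rewrite power_sumS -addrA -scalerDl -[G m.+1]/(0 + T m.+1) add0r subrr.
  by rewrite scale0r addr0.
rewrite power_sumS -P1; congr (_ + _%:A).
(* The scalar gained by the first projection is read off by applying [phi] before and after the
   factor 1 + e2. *)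
have := phi_projections phi1 hS c1 h2; rewrite (negPf c12) eqxx.
have := phi_projections phi1 hS c1 h1; rewrite eqxx => e.
rewrite linearD -e linearZ /= phi1 mulr1 /F exprSr /x mulrA => ->.
by rewrite addrAC subrr add0r.
Qed.

Lemma moment_series_left_factor : H1 * F = H.
Proof.
apply/funext => m; have [P hP [e _]] := projections_power m.
by rewrite -phi_power_sum -e -(phi_projections phi1 hS c1 hP).
Qed.

(** Meant for D = eta_(1 + e1) / z. The second projection gives H2 G = H + T, while e1 = (1 + e1) -
    1 in the first gives T = (D H1 - H1) F = H D - H. *)
Lemma moment_series_right_factor (D : series C) :
  series_tail H1 = D * H1 -> H2 * G = H * D.
Proof.
move=> hD.
have eH : H2 * G - T = H.
  apply/funext => m; have [P hP [_ e]] := projections_power m.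
  rewrite -[LHS]/((H2 * G) m - T m) -phi_power_sum.
  rewrite -[RHS]/(phi (x ^+ m)) (phi_projections phi1 hS c2 hP) e.
  by rewrite linearD linearZ /= phi1 mulr1.
have eT : T = (D * H1 - H1) * F.
  apply/funext => m; have [P hP [e _]] := projections_power m.
  have := projections_mul hS hP Se1 => /(phi_projections phi1 hS c1).
  rewrite eqxx /T => ->; rewrite e /power_sum mulr_suml linear_sum.
  apply: eq_bigr => i _; rewrite -scalerAl linearZ /= mulrC; congr (_ * _).
  rewrite -hD -[RHS]/(phi ((1 + e1) ^+ i.+1) - phi ((1 + e1) ^+ i)) exprSr.
  by rewrite mulrDr mulr1 linearD addrAC subrr add0r.
have -> : H2 * G = H + T by rewrite -eH subrK.
by rewrite eT -moment_series_left_factor; ring.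
Qed.

End Product.
End Powers.

(** * From moments and covariances back to the eta-transforms *)

Section EtaTransform.
Variables (C : fieldType) (A : algType C) (phi : {scalar A}).
Hypothesis phi1 : phi 1 = 1.
Variables (B : functional_family A) (hB : is_lr_cumulants phi B).

Lemma moment_series_tail p : series_tail (moment_series phi p) =
  series_tail (eta_transform B p : series C) * moment_series phi p.
Proof.
apply/funext => m; rewrite /series_tail [in LHS](moment_series_eta phi1 hB).
rewrite -[LHS]/(0 + \sum_(i < m.+2) _) add0r big_ord_recl mul0r add0r.
by apply: eq_bigr => i _.
Qed.

(** Subtracting the product of the marginal moments removes the constant 1 from
    [joint_moment_series_eta]. *)
Lemma covariance_series_eta p r : covariance_series phi p r =
  emb_z (moment_series phi p) * emb_w (moment_series phi r) *
    (reduced_eta_transform B p r : series (series C)).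
Proof.
have e : covariance_series phi p r = joint_moment_series phi p r -
    emb_z (moment_series phi p) * emb_w (moment_series phi r).
  apply/funext => m; apply/funext => n.
  rewrite -[RHS]/(phi (p ^+ m * r ^+ n) -
    (emb_z (moment_series phi p) * emb_w (moment_series phi r)) m n).
  congr (_ - _); rewrite coef_emb_z big_ord_recr /= subnn big1 ?add0r // => i _.
  by rewrite /emb_w /in_w ifN ?mulr0 // subn_eq0 -ltnNge.
by rewrite e (joint_moment_series_eta phi1 hB); ring.
Qed.

Lemma moment_series_unit p :
  moment_series phi p * (1 - (eta_transform B p : series C)) = 1.
Proof. by have e := moment_series_eta phi1 hB p; rewrite mulrBr mulr1 {1}e; ring. Qed.

End EtaTransform.

(** * Cancellation and conclusion *)

Local Open Scope complex_scope.

Lemma nonunital_alg_gen (C : fieldType) (A : algType C) (a : A) : nonunital_alg a a.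
Proof. by move=> P [_]; apply. Qed.

(** Here X and Y stand for H_x and H_y, with inverses X' and Y'; Dz and Dw are the divided eta
    series, and E, E1, E2 the reduced transforms. *)
Lemma factor_cancel (T : comPzRingType)
    (X Y X' Y' X1 X2 Y1 Y2 F G F' G' Dz Dw E E1 E2 : T) :
  X * X' = 1 -> Y * Y' = 1 ->
  X1 * F = X -> X2 * G = X * Dz -> Y2 * F' = Y -> Y1 * G' = Y * Dw ->
  X * Y * E = F * G' * (X1 * Y1 * E1) + G * F' * (X2 * Y2 * E2) ->
  E = Dz * E2 + Dw * E1.
Proof.
move=> ux uy eF eG eF' eG' e.
have -> : E = X * X' * (Y * Y') * E by rewrite ux uy !mul1r.
transitivity (X' * Y' * (X * Y * E)); first by ring.
have {}e : X * Y * E = (X1 * F) * (Y1 * G') * E1 + (X2 * G) * (Y2 * F') * E2.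
  by rewrite e; ring.
rewrite e eF eG eF' eG'.
transitivity (X * X' * (Y * Y') * (Dz * E2 + Dw * E1)); first by ring.
by rewrite ux uy !mul1r.
Qed.

Theorem theorem4p14 (R : realType) (A : algType R[i]) (phi : {scalar A})
    (phi1 : phi 1 = 1)
    (B : functional_family A) (hB : is_lr_cumulants phi B)
    (a1 b1 a2 b2 : A)
    (hind : pairs_bi_Boolean_independent phi a1 b1 a2 b2) :
  reduced_eta_transform B ((1 + a1) * (1 + a2)) ((1 + b2) * (1 + b1)) =
  (div_z (in_z (eta_transform B (1 + a1)%R)) * reduced_eta_transform B (1 + a2)%R (1 + b2)%R
   + div_w (in_w (eta_transform B (1 + b2)%R)) * reduced_eta_transform B (1 + a1)%R (1 + b1)%R)%fps2.
Proof.
rewrite fps2_addE !fps2_mulE.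
set x := (1 + a1) * _; set y := (1 + b2) * _.
pose c0 : 'I_2 := ord0; pose c1 : 'I_2 := lift ord0 ord0.
pose S (k : 'I_2) s := match s with
  | Left => nonunital_alg (if k == 0 then a1 else a2)
  | Right => nonunital_alg (if k == 0 then b1 else b2) end.
have hS : bi_Boolean_independent phi S := hind.
have Sa1 : S c0 Left a1 by apply: nonunital_alg_gen.
have Sa2 : S c1 Left a2 by apply: nonunital_alg_gen.
have Sb1 : S c0 Right b1 by apply: nonunital_alg_gen.
have Sb2 : S c1 Right b2 by apply: nonunital_alg_gen.
have c01 : c0 != c1 by [].
have c10 : c1 != c0 by [].
have PL := projections_power phi1 hS c01 Sa1 Sa2.
(* The right product begins with 1 + b2, so the colours exchange their roles. *)
have PR := projections_power phi1 hS c10 Sb2 Sb1.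
have FL := moment_series_left_factor phi1 hS c01 Sa1 Sa2.
have FR := moment_series_left_factor phi1 hS c10 Sb2 Sb1.
have GL := moment_series_right_factor phi1 hS c01 Sa1 Sa2
  (moment_series_tail phi1 hB (1 + a1)).
have GR := moment_series_right_factor phi1 hS c10 Sb2 Sb1
  (moment_series_tail phi1 hB (1 + b2)).
move: PL PR FL FR GL GR; rewrite -/x -/y.
set F := (X in power_sum X (1 + a1)).
set G := (X in power_sum X (1 + a2)).
set F' := (X in power_sum X (1 + b2)).
set G' := (X in power_sum X (1 + b1)).
move=> PL PR FL FR GL GR.
have cov : covariance_series phi x y =
    emb_z F * emb_w G' * covariance_series phi (1 + a1) (1 + b1) +
    emb_z G * emb_w F' * covariance_series phi (1 + a2) (1 + b2).
  apply/funext => m; apply/funext => n.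
  have [P hP [P0 P1]] := PL m; have [Q hQ [Q1 Q0]] := PR n.
  rewrite -[LHS]/(covariance phi (x ^+ m) (y ^+ n)).
  rewrite (covariance_projections phi1 hS hP hQ) !big_ord_recl big_ord0 addr0.
  (* A zero scalar is added to match the form of [covariance_power_sum]. *)
  rewrite -/c0 -/c1 P0 P1 Q0 Q1 -[power_sum F _ _]addr0 -[power_sum F' _ _]addr0.
  by rewrite -(scale0r 1) !covariance_power_sum.
have ux := congr1 (@emb_z _) (moment_series_unit phi1 hB x).
have uy := congr1 (@emb_w _) (moment_series_unit phi1 hB y).
move: FL FR GL GR ux uy => /(congr1 (@emb_z _)) FL /(congr1 (@emb_w _)) FR.
move=> /(congr1 (@emb_z _)) GL /(congr1 (@emb_w _)) GR ux uy.
rewrite emb_zM emb_z1 in ux; rewrite emb_wM emb_w1 in uy.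
rewrite emb_zM in FL; rewrite emb_wM in FR.
rewrite !emb_zM in GL; rewrite !emb_wM in GR.
rewrite !(covariance_series_eta phi1 hB) in cov.
(* [div_z (in_z f)] is convertible to [emb_z (series_tail f)], and likewise in w. *)
exact: factor_cancel ux uy FL GL FR GR cov.
Qed.
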